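(* Assume that the stationary Markov chain $(X_t)_{t\in\mathbb Z}$ is reversible, and let $K$ denote the transition operator of this base chain acting on $L^2_0(\nu)$. For every $\lambda\in\operatorname{Spec}(K)\setminus\{1\}$, define $$\theta_k(\lambda)=\frac{k-(k-2)\lambda}{1-\lambda}.$$ Then, on the marginal subspace generated by one-coordinate functions in the $k$-window space, the operator $B_k$ admits $\theta_k(\lambda)$, $\lambda\in\operatorname{Spec}(K)\setminus\{1\}$, as eigenvalues. More precisely, if a nonzero $h\in L^2_0(\nu)$ satisfies $Kh=\lambda h$, then the boundary-corrected function $$M_{\lambda,k}(x_1,\ldots,x_k)=\frac{1}{1-\lambda}h(x_1)+\sum_{i=2}^{k-1}h(x_i)+\frac{1}{1-\lambda}h(x_k)$$ is an eigenfunction of $B_k$ with eigenvalue $\theta_k(\lambda)$.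
   Context: $(X_t)_{t\in\mathbb Z}$ is a stationary Markov chain on a measurable space $(E,\mathcal E)$ with invariant distribution $\nu$ and transition kernel $K$, and $k\ge2$ is a fixed block length. The kernel acts on $L^2(\nu)$ by $(Kh)(x)=\int_E h(y)\,K(x,dy)$ and maps $L^2_0(\nu)=\{h\in L^2(\nu):\int h\,d\nu=0\}$ into itself. Reversibility means $K^*=K$, where $K^*$ is the time-reversal of $K$ with respect to $\nu$; $\operatorname{Spec}(K)$ is the spectrum of $K$. $\pi_k$ is the law of $(X_1,\ldots,X_k)$, i.e. $\pi_k(dx_1,\ldots,dx_k)=\nu(dx_1)K(x_1,dx_2)\cdots K(x_{k-1},dx_k)$, and $\mathcal H_k=L^2_0(\pi_k)$ is the Hilbert space of square-integrable real functions $f$ on $E^k$ with $\int f\,d\pi_k=0$ (the $k$-window space). The transition operator of the $k$-window chain $(X_t,\ldots,X_{t+k-1})$ acts on $\mathcal H_k$ by $$(P_kf)(x_1,\ldots,x_k)=\int_E f(x_2,\ldots,x_k,z)\,K(x_k,dz),$$ and $P_k^*$ is its adjoint on $\mathcal H_k$. The Green--Kubo covariance operator is $$B_k=I+\sum_{r\ge1}P_k^r+\sum_{r\ge1}(P_k^* )^r.$$ Standing assumption: this series converges on the class of functions under consideration, and all spectral statements about $B_k$ are understood on this domain. The marginal subspace generated by one-coordinate functions is the closure in $\mathcal H_k$ of the set of functions $a_1(x_1)+\cdots+a_k(x_k)$ with $a_i\in L^2_0(\nu)$. For $k=2$ the sum $\sum_{i=2}^{k-1}$ is empty.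
   Formalization: The claim that B_k has eigenvalue θ_k(λ) for every λ in Spec(K)\{1} is proved only for λ that are eigenvalues of K, with an eigenfunction h in L²_0(ν); it is false for λ in the continuous spectrum. *)

(* Defs.v *)
From HB Require Import structures.
From mathcomp Require Import all_boot all_order all_algebra.
From mathcomp Require Import all_classical all_reals all_analysis measurable_realfun.

Set Implicit Arguments.
Unset Strict Implicit.
Unset Printing Implicit Defensive.
Import Order.TTheory GRing.Theory Num.Theory.
Import numFieldNormedType.Exports.

Local Open Scope classical_set_scope.
Local Open Scope ring_scope.

(* Square-integrable functions are represented by functions, not classes:
   equality in L^2(mu) is equality mu-almost everywhere. *)
Section L2.
Context d (T : measurableType d) (R : realType) (mu : probability T R).
Implicit Types f g : T -> R.

Definition norm2 f : \bar R := ('N[mu]_2%:E[EFin \o f])%E.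

Definition dot f g : R := \int[mu]_x (f x * g x).

Definition L20 f : Prop := f \in Lfun mu 2%:E /\ \int[mu]_x f x = 0.

Definition cvg_L2 (u : nat -> T -> R) (f : T -> R) : Prop :=
  norm2 (fun x => u n x - f x) @[n --> \oo] --> 0%E.

End L2.

Section chain.
Context dE (E : measurableType dE) (R : realType).
Variables (nu : probability E R) (K : R.-pker E ~> E).

Definition invariant : Prop :=
  forall A, measurable A -> (\int[nu]_x K x A)%E = nu A.

(* K' is the time-reversal of K: nu(dx) K(x, dy) = nu(dy) K'(y, dx) *)
Definition time_reversal (K' : R.-pker E ~> E) : Prop :=
  forall A B, measurable A -> measurable B ->
    (\int[nu]_(x in A) K x B)%E = (\int[nu]_(y in B) K' y A)%E.

Definition reversible : Prop := time_reversal K.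

Definition Kop (h : E -> R) (x : E) : R := \int[K x]_y h y.

(* lambda is in the resolvent set when K - lambda I is onto L^2_0(nu) and has
   a bounded inverse there.  The spectrum of a self-adjoint operator is real,
   so real lambda suffice. *)
Definition resolvent (lambda : R) : Prop :=
  (exists C : R, forall h, L20 nu h ->
     (norm2 nu h <= C%:E * norm2 nu (fun x => Kop h x - lambda * h x)%R)%E) /\
  (forall g, L20 nu g -> exists2 h, L20 nu h &
     (fun x => Kop h x - lambda * h x) = g %[ae nu]).

Definition Spec : set R := [set lambda | ~ resolvent lambda].

Lemma measurable_Kop h : measurable_fun setT h -> measurable_fun setT (Kop h).
Proof.
move=> mh; rewrite /Kop /Rintegral.
apply: (measurableT_comp (fine_measurable measurableT)) => //.
under eq_fun do rewrite integralE.
apply: emeasurable_funB; apply: measurable_fun_integral_kernel => //;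
  try (by move=> U mU; exact: measurable_kernel).
- by apply: measurable_funepos; exact/measurable_EFinP.
- by apply: measurable_funeneg; exact/measurable_EFinP.
Qed.

Lemma eigenvalue_Spec lambda h : L20 nu h -> ~ (h = cst 0 %[ae nu]) ->
  Kop h = (fun x => lambda * h x) %[ae nu] -> Spec lambda.
Proof.
move=> Lh h0 Kh [[C /(_ h Lh) hC] _]; apply: h0.
have mh : measurable_fun setT h.
  by case: Lh => /sub_Lfun_mfun; rewrite inE.
pose g x := Kop h x - lambda * h x.
have mg : measurable_fun setT g.
  apply: measurable_funB; first exact: measurable_Kop.
  exact: measurable_funM.
have N0 : norm2 nu g = 0%E.
  rewrite /norm2 unlock (_ : (\int[nu]_x _)%E = 0%E) ?poweR0r ?invr_neq0//.
  rewrite -[RHS](integral0 nu setT); apply: ae_eq_integral => //.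
    apply: (@measurableT_comp _ _ _ _ _ _ (fun x => x `^ 2)%E) => //.
      exact: measurable_poweR.
    by apply: measurableT_comp => //; exact/measurable_EFinP.
  by apply: filterS Kh => x Kh _; rewrite /= /g Kh// subrr normr0 powR0.
have : norm2 nu h = 0%E.
  by apply/eqP; rewrite eq_le Lnorm_ge0 andbT; move: hC; rewrite N0 mule0.
move=> /Lnorm_eq0_eq0 h0; have : EFin \o h = \0 %[ae nu].
  by apply: h0 => //; exact/measurable_EFinP.
by apply: filterS => x /(_ I) [] ->.
Qed.

Section process.
Context dO (Omega : measurableType dO) (P : probability Omega R).
Variable X : int -> {RV P >-> E}.

Definition past (t : int) : set (set Omega) :=
  <<s [set B | exists s A, [/\ (s <= t)%R, measurable A & B = X s @^-1` A]] >>.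

Definition stationary_markov_chain : Prop :=
  [/\ invariant,
      forall t A, measurable A -> distribution P (X t) A = nu A
    & forall t A B, measurable A -> past t B ->
        P (B `&` X (t + 1) @^-1` A) = (\int[P]_(w in B) K (X t w) A)%E].

Definition window (k : nat) (w : Omega) : k.-tuple E :=
  [tuple X i.+1%:Z w | i < k].

Lemma measurable_window k : measurable_fun setT (window k).
Proof.
apply/measurable_fun_tnthP => i.
rewrite (_ : _ \o _ = X i.+1%:Z) ?measurable_funPT//.
by apply/funext => w /=; rewrite tnth_mktuple.
Qed.

HB.instance Definition _ k := @isMeasurableFun.Build _ _ _ _
  (window k) (@measurable_window k).

Definition window_law (k : nat) : probability (k.-tuple E) R :=
  distribution P (window k : {RV P >-> k.-tuple E}).

End process.

Section window_space.
Variables (k : nat) (pi : probability (k.-tuple E) R).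
Implicit Types f g : k.-tuple E -> R.

(* (x_1, ..., x_k), z |-> (x_2, ..., x_k, z): the default value z of nth is
   reached exactly at the last position i = k - 1. *)
Definition shift_window (x : k.-tuple E) (z : E) : k.-tuple E :=
  [tuple nth z x i.+1 | i < k].

Definition Pk f (x : k.-tuple E) : R :=
  \int[K (nth point x k.-1)]_z f (shift_window x z).

(* g is the image of f by the adjoint of P_k on L^2_0(pi) *)
Definition Pk_adjoint f g : Prop :=
  L20 pi g /\ forall u, L20 pi u -> dot pi (Pk u) f = dot pi u g.

(* b r represents the image of f by the r-th power of the adjoint of P_k; it
   is unique up to pi-null sets. *)
Definition Pk_adjoint_powers f (b : nat -> k.-tuple E -> R) : Prop :=
  b 0%N = f /\ forall r, Pk_adjoint (b r) (b r.+1).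

(* f is in the domain of the Green--Kubo operator, i.e. both series converge
   in L^2(pi), and B_k f = g *)
Definition green_kubo f g : Prop :=
  [/\ L20 pi f, L20 pi g &
  exists s, exists s', exists b : nat -> k.-tuple E -> R,
    [/\ L20 pi s /\ L20 pi s', Pk_adjoint_powers f b,
        cvg_L2 pi (fun n x => \sum_(1 <= r < n.+1) iter r Pk f x) s,
        cvg_L2 pi (fun n x => \sum_(1 <= r < n.+1) b r x) s'
      & g = (fun x => f x + s x + s' x) %[ae pi]] ].

Definition green_kubo_dom : set (k.-tuple E -> R) :=
  [set f | exists g, green_kubo f g].

Definition green_kubo_eigenfunction (theta : R) f : Prop :=
  [/\ L20 pi f, ~ (f = cst 0 %[ae pi]) & green_kubo f (fun x => theta * f x)].

(* x |-> a (x_{i+1}): coordinates are counted from 0 *)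
Definition coordinate_fun (a : E -> R) (i : nat) : k.-tuple E -> R :=
  fun x => a (nth point x i).

Definition marginal_subspace : set (k.-tuple E -> R) :=
  [set f | L20 pi f /\ forall eps : R, 0 < eps ->
     exists2 a : 'I_k -> E -> R, (forall i, L20 nu (a i)) &
       (norm2 pi (fun x => f x - \sum_(i < k) coordinate_fun (a i) i x)%R
         < eps%:E)%E].

Definition Mfun (lambda : R) (h : E -> R) (x : k.-tuple E) : R :=
  (1 - lambda)^-1 * coordinate_fun h 0 x
  + \sum_(1 <= i < k.-1) coordinate_fun h i x
  + (1 - lambda)^-1 * coordinate_fun h k.-1 x.

End window_space.
End chain.

Definition theta (R : realType) (k : nat) (lambda : R) : R :=
  (k%:R - (k%:R - 2) * lambda) / (1 - lambda).

(* Main.v *)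
From HB Require Import structures.
Require Import Defs.
From mathcomp Require Import all_boot all_order all_algebra.
From mathcomp Require Import ring lra zify.
From mathcomp Require Import all_classical all_reals all_analysis measurable_realfun.
Import Order.TTheory GRing.Theory Num.Theory.
Import numFieldNormedType.Exports.
Local Open Scope classical_set_scope.
Local Open Scope ring_scope.

Set Implicit Arguments.
Unset Strict Implicit.
Unset Printing Implicit Defensive.

(* Write e_j for the function x |-> h(x_j).  If K h = lambda h, the span of
   e_1, ..., e_k is stable under P_k, which maps e_j to e_(j+1) for j < k and
   e_k to lambda e_k, and, by reversibility, under its adjoint, which acts in
   the mirror-image way: e_j goes to e_(j-1) and e_1 to lambda e_1.  The
   adjoint is identified by showing that the window kernel and the kernel that
   prepends a K-step to the window are time-reversals of each other with
   respect to pi_k.  Convergence of the series at e_k forces |lambda| < 1, so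
   both series can be summed by solving a linear system for the coefficients;
   every e_j is mapped by B_k to M_{lambda,k}, whose coefficients add up to
   theta_k(lambda). *)

(** * Mixtures of kernels *)

(** The image of e_j under B_k is the same for all j because its two orbits together run once
    through the other coordinates; from then on P_k stays at e_k and the adjoint at e_1, each adding
    a geometric tail lambda / (1 - lambda). Hence B_k e_j = e_1 + ... + e_k + lambda / (1 - lambda)
    (e_1 + e_k), and the boundary weight of M is 1 / (1 - lambda) = 1 + lambda / (1 - lambda). The
    obstacle is that functions stand for classes, that real-valued integrals are linear only on
    integrable functions, and that the adjoint is given by duality and not by a formula. Identities
    between kernels are therefore extended from sets to nonnegative extended-real functions, where
    integrability is no issue, and from there to L^2 by subtraction. Mixtures make the first
    extension uniform: two of them that agree on sets have the same integrals, and each integral is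
    an iterated one. For the window kernels, the two masses to be compared are both the probability
    that (X_1, ..., X_k) lies in A and (X_2, ..., X_{k+1}) lies in B. *)

(** Multiplication by c = +oo is continuous away from 0; the bound by l settles l = 0, since the
    sequence is then identically 0. *)
Lemma ge0_cvgeZl (R : realType) (c l : \bar R) (u : (\bar R)^nat) :
  (0 <= c)%E -> (forall n, 0 <= u n <= l)%E -> u n @[n --> \oo] --> l ->
  (c * u n)%E @[n --> \oo] --> (c * l)%E.
Proof.
move=> c0 ul cu.
have [cfin|] := boolP (c \is a fin_num); first exact: cvgeZl.
rewrite ge0_fin_numE// -leNgt leye_eq => /eqP ->.
have [l0|l0] := eqVneq l 0%E.
  rewrite (_ : (fun _ => _) = cst 0%E) ?l0 ?mule0; first exact: cvg_cst.
  apply/funext => n; rewrite (_ : u n = 0%E) ?mule0//.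
  by apply/eqP; rewrite eq_le andbC -{2}l0; exact: ul.
apply: cvgeM cu; last exact: cvg_cst.
by apply: mule_def_infty_neq0.
Qed.

Section mixture.
Local Open Scope ereal_scope.
Context d d' (Y : measurableType d) (T : measurableType d') (R : realType).
Variables (m : {measure set Y -> \bar R}) (w : Y -> \bar R).
Variable kap : R.-ker Y ~> T.

(* A density is the case of a Dirac kernel, the image of a measure under a
   kernel is the case of weight 1. *)
Definition mixture (w0 : forall y, 0 <= w y) (mw : measurable_fun setT w)
  (A : set T) : \bar R := \int[m]_y (w y * kap y A).

Hypotheses (w0 : forall y, 0 <= w y) (mw : measurable_fun setT w).

Let mixture_set0 : mixture w0 mw set0 = 0.
Proof. by rewrite /mixture integral0_eq// => y _; rewrite measure0 mule0. Qed.

Let mixture_ge0 A : 0 <= mixture w0 mw A.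
Proof. by apply: integral_ge0 => y _; rewrite mule_ge0. Qed.

Let measurable_wkap A : measurable A ->
  measurable_fun setT (fun y => w y * kap y A).
Proof. by move=> mA; apply: emeasurable_funM => //; exact: measurable_kernel. Qed.

Let mixture_sigma_additive : semi_sigma_additive (mixture w0 mw).
Proof.
move=> F mF tF mUF; rewrite [X in _ --> X](_ : _ =
  \sum_(n <oo) \int[m]_y (w y * kap y (F n))).
  by apply: is_cvg_ereal_nneg_natsum => n _; exact: mixture_ge0.
rewrite -integral_nneseries//; first last.
- by move=> n y _; rewrite mule_ge0.
- by move=> n; exact: measurable_wkap.
apply: eq_integral => y _; rewrite [RHS](_ : _ =
  limn (fun n => w y * \sum_(0 <= i < n) kap y (F i))); last first.
  congr (limn _); apply/funext => n.
  by rewrite ge0_sume_distrr.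
apply/esym/cvg_lim => //; apply: ge0_cvgeZl => //.
  move=> n; rewrite sume_ge0//=.
  rewrite measure_semi_bigcup//.
  exact: nneseries_lim_ge.
exact: measure_semi_sigma_additive.
Qed.

HB.instance Definition _ := isMeasure.Build _ _ _ (mixture w0 mw)
  mixture_set0 mixture_ge0 mixture_sigma_additive.

Import HBNNSimple.

Let integral_mixture_nnsfun (f : {nnsfun T >-> R}) :
  \int[mixture w0 mw]_z (f z)%:E = \int[m]_y (w y * \int[kap y]_z (f z)%:E).
Proof.
have nn0 r : 0 <= r%:E * mixture w0 mw (f @^-1` [set r]).
  have [r0|r0] := leP 0%R r; first by rewrite mule_ge0.
  by rewrite preimage_nnfun0// measure0 mule0.
rewrite integralT_nnsfun sintegralE.
under [RHS]eq_integral => y _.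
  rewrite integralT_nnsfun sintegralE ge0_mule_fsumr; last first.
    move=> r; have [r0|r0] := leP 0%R r; first by rewrite mule_ge0.
    by rewrite preimage_nnfun0// measure0 mule0.
  over.
rewrite /= ge0_integral_fsum//.
- apply: eq_fsbigr => r _.
  under [RHS]eq_integral do rewrite muleCA.
  have [r0|r0] := leP 0%R r.
    rewrite ge0_integralZl//; first exact: measurable_wkap.
    by move=> y _; rewrite mule_ge0.
  rewrite preimage_nnfun0// measure0 mule0 integral0_eq// => y _.
  by rewrite measure0 !mule0.
- move=> r; under eq_fun do rewrite muleCA.
  by apply: measurable_funeM; exact: measurable_wkap.
- move=> r y _; have [r0|r0] := leP 0%R r; first by rewrite !mule_ge0.
  by rewrite preimage_nnfun0// measure0 !mule0.
Qed.

(** Simple functions are handled by linearity; monotone convergence is then used for the mixture,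
    for each [kap y] and for the outer integral. *)
Lemma integral_mixture f : (forall z, 0 <= f z) -> measurable_fun setT f ->
  \int[mixture w0 mw]_z f z = \int[m]_y (w y * \int[kap y]_z f z).
Proof.
move=> f0 mf; pose f_ := nnsfun_approx measurableT mf.
have mf_ n : measurable_fun setT (EFin \o f_ n) by exact/measurable_EFinP.
have f_0 n z : 0 <= (f_ n z)%:E by rewrite lee_fin.
have ndf_ z : {homo (fun n => (f_ n z)%:E) : a b / (a <= b)%N >-> a <= b}.
  by move=> a b ab; rewrite lee_fin; exact/lefP/nd_nnsfun_approx.
have f_f (mu : {measure set T -> \bar R}) :
    \int[mu]_z (f_ n z)%:E @[n --> \oo] --> \int[mu]_z f z.
  have -> : \int[mu]_z f z = \int[mu]_z limn (fun n => (f_ n z)%:E).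
    apply: eq_integral => z _; apply/esym/cvg_lim => //.
    exact: cvg_nnsfun_approx.
  exact: cvg_monotone_convergence.
have mk n : measurable_fun setT (fun y => \int[kap y]_z (f_ n z)%:E).
  exact: (measurable_fun_integral_kernel (@measurable_kernel _ _ _ _ _ kap) (f_0 n) (mf_ n)).
apply: (cvg_unique _ (f_f _)) => //=.
under eq_fun do rewrite integral_mixture_nnsfun.
have -> : \int[m]_y (w y * \int[kap y]_z f z) =
    \int[m]_y limn (fun n => w y * \int[kap y]_z (f_ n z)%:E); last first.
  apply: cvg_monotone_convergence => //.
  - by move=> n; exact: emeasurable_funM.
  - by move=> n y _; rewrite mule_ge0// integral_ge0.
  - move=> y _ a b ab; apply: lee_wpmul2l => //.
    apply: ge0_le_integral => // [||z _]; [exact: mf_|exact: mf_|exact: ndf_].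
apply: eq_integral => y _; apply/esym/cvg_lim => //.
apply: ge0_cvgeZl (f_f _) => // n; rewrite integral_ge0//=.
apply: ge0_le_integral => // [|z _]; first exact: mf_.
have cf := cvg_nnsfun_approx measurableT mf (fun z _ => f0 z) (Logic.I : setT z).
rewrite -(cvg_lim _ cf)//; apply: lime_ge; first exact: cvgP cf.
by exists n => //= k /= nk; exact: ndf_.
Qed.
End mixture.

(** * Time reversal in L^2 *)

Lemma integral_indicl d (T : measurableType d) (R : realType)
    (mu : {measure set T -> \bar R}) (A : set T) (f : T -> \bar R) :
  (\int[mu]_(x in A) f x = \int[mu]_x ((\1_A x)%:E * f x))%E.
Proof.
by rewrite integral_mkcond epatch_indic; apply: eq_integral => x _; rewrite muleC.
Qed.

Section time_reversal.
Local Open Scope ereal_scope.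
Context d (T : measurableType d) (R : realType) (mu : probability T R).
Variables Q Q' : R.-pker T ~> T.

Lemma time_reversal_sym : time_reversal mu Q Q' -> time_reversal mu Q' Q.
Proof. by move=> rev A B mA mB; rewrite rev. Qed.

Hypothesis rev : time_reversal mu Q Q'.

(** Reversal is known on pairs of sets. With one argument fixed, both sides are integrals against
    mixtures, which are equal once they agree on sets. This frees u while f is an indicator, and
    then f. *)
Lemma time_reversal_integral (u f : T -> \bar R) :
    (forall x, 0 <= u x) -> measurable_fun setT u ->
    (forall x, 0 <= f x) -> measurable_fun setT f ->
  \int[mu]_x (f x * \int[Q x]_y u y) = \int[mu]_y (u y * \int[Q' y]_x f x).
Proof.
move=> u0 mu_ f0 mf.
have mid : measurable_fun setT (@id T) by exact: measurable_id.
have Qu0 x : 0 <= \int[Q x]_y u y by exact: integral_ge0.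
have mQu := measurable_fun_integral_kernel (@measurable_kernel _ _ _ _ _ Q) u0 mu_.
have revu A : measurable A ->
    \int[mu]_x ((\1_A x)%:E * \int[Q x]_y u y) = \int[mu]_y (u y * Q' y A).
  move=> mA.
  have A0 x : 0 <= (\1_A x)%:E :> \bar R by rewrite lee_fin.
  have m1A : measurable_fun setT (fun x => (\1_A x)%:E : \bar R).
    exact/measurable_EFinP.
  have Q'0 x : 0 <= Q' x A by [].
  have mQ' := measurable_kernel Q' A mA.
  rewrite -(integral_mixture mu Q A0 m1A)//.
  rewrite (eq_measure_integral (mixture mu (kdirac mid) Q'0 mQ')); last first.
    move=> B mB _; rewrite /mixture.
    transitivity (\int[mu]_(x in A) Q x B); first by rewrite integral_indicl.
    rewrite rev// integral_indicl.
    by apply: eq_integral => y _; rewrite muleC.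
  rewrite integral_mixture//; apply: eq_integral => y _.
  by rewrite integral_dirac// diracT mul1e muleC.
transitivity (\int[mixture mu (kdirac mid) Qu0 mQu]_x f x).
  rewrite integral_mixture//; apply: eq_integral => x _.
  by rewrite integral_dirac// diracT mul1e muleC.
rewrite (eq_measure_integral (mixture mu Q' u0 mu_)) ?integral_mixture// => A mA _.
rewrite /mixture -[RHS]revu//.
by apply: eq_integral => x _; rewrite muleC.
Qed.

Lemma time_reversal_invariant (u : T -> \bar R) :
    (forall x, 0 <= u x) -> measurable_fun setT u ->
  \int[mu]_x \int[Q x]_y u y = \int[mu]_x u x.
Proof.
move=> u0 mu_; have := @time_reversal_integral u (cst 1) u0 mu_ (fun=> lee01).
under eq_integral do rewrite mul1e; move=> ->//.
by apply: eq_integral => x _; rewrite integral_cst// prob_kernel !mule1.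
Qed.

End time_reversal.

Section invariant_kernel.
Context d (T : measurableType d) (R : realType) (mu : probability T R).
Variable Q : R.-pker T ~> T.
Hypothesis inv : forall u : T -> \bar R, (forall x, 0 <= u x)%E ->
  measurable_fun setT u ->
  (\int[mu]_x \int[Q x]_y u y = \int[mu]_x u x)%E.
Implicit Types f g u : T -> R.

(** A mu-null set need not be null for every [Q x], but by invariance it is for mu-almost every x:
    the integral of |f - g| against [Q x] has mu-mean zero. *)
Lemma Kop_ae_eq f g : measurable_fun setT f -> measurable_fun setT g ->
  f = g %[ae mu] -> Kop Q f = Kop Q g %[ae mu].
Proof.
move=> mf mg fg; pose D x := (`|f x - g x|)%:E.
have D0 x : (0 <= D x)%E by rewrite lee_fin.
have mfg : measurable_fun setT (EFin \o (f \- g)).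
  by apply/measurable_EFinP; exact: measurable_funB.
have mD : measurable_fun setT D.
  by apply/measurable_EFinP; apply: measurableT_comp => //; exact: measurable_funB.
have mQD := measurable_fun_integral_kernel (@measurable_kernel _ _ _ _ _ Q) D0 mD.
have : (\int[mu]_x `|\int[Q x]_y D y| = 0)%E.
  under eq_integral do rewrite gee0_abs ?integral_ge0//.
  rewrite inv//; apply/(ae_eq_integral_abs mu measurableT mfg).
  by apply: filterS fg => x fg _; rewrite /= fg// subrr.
move/(ae_eq_integral_abs mu measurableT mQD); apply: filterS => x Dx _.
have := Dx I; rewrite /D => /(ae_eq_integral_abs (Q x) measurableT mfg) fgx.
congr fine; apply: ae_eq_integral => //; [exact/measurable_EFinP..|].
by apply: filterS fgx => y fgy _; congr EFin; apply/eqP; rewrite -subr_eq0;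
  have [->] := fgy I.
Qed.

(** By invariance the integral of |u| against [Q x] has a finite mu-mean, so it is finite for almost
    every x. At such x the real-valued integral is linear. *)
Lemma integrable_kernel_ae u : mu.-integrable setT (EFin \o u) ->
  {ae mu, forall x, (Q x).-integrable setT (EFin \o u)}.
Proof.
move=> /integrableP[mu_ uoo].
have mau : measurable_fun setT (fun y => `|(u y)%:E|)%E by exact: measurableT_comp.
have mQu := measurable_fun_integral_kernel (@measurable_kernel _ _ _ _ _ Q)
  (fun y => abse_ge0 (u y)%:E) mau.
have /integrable_ae -/(_ measurableT) :
    mu.-integrable setT (fun x => \int[Q x]_y `|(u y)%:E|)%E.
  apply/integrableP; split => //.
  under eq_integral do rewrite gee0_abs ?integral_ge0//.
  by rewrite inv.
apply: filterS => x /(_ I); rewrite ge0_fin_numE ?integral_ge0// => xoo.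
exact/integrableP.
Qed.

Lemma KopB_ae f g : mu.-integrable setT (EFin \o f) ->
  mu.-integrable setT (EFin \o g) ->
  Kop Q (f \- g) = Kop Q f \- Kop Q g %[ae mu].
Proof.
move=> /integrable_kernel_ae + /integrable_kernel_ae.
by apply: filterS2 => x fx gx _; rewrite /Kop RintegralB.
Qed.

Lemma Lfun2_mfun f : f \in Lfun mu 2%:E -> measurable_fun setT f.
Proof. by move=> /sub_Lfun_mfun; rewrite inE. Qed.

Lemma Lfun2_integrable f : f \in Lfun mu 2%:E -> mu.-integrable setT (EFin \o f).
Proof.
by move=> f2; apply/Lfun1_integrable/Lfun_subset12 => //; rewrite fin_num_measure.
Qed.

(** The pointwise bound |f(x)| |u(y)| <= f(x)^2 + u(y)^2, integrated in y, dominates the product by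
    a function that is integrable thanks to invariance. *)
Lemma integrable_Kop_mul f u : f \in Lfun mu 2%:E -> u \in Lfun mu 2%:E ->
  mu.-integrable setT (EFin \o (Kop Q u \* f)).
Proof.
move=> f2 u2; have mf := Lfun2_mfun f2; have mu_ := Lfun2_mfun u2.
have mau : measurable_fun setT (fun y => `|(u y)%:E|)%E.
  by apply: measurableT_comp => //; exact/measurable_EFinP.
have u20 y : (0 <= (u y ^+ 2)%:E)%E by rewrite lee_fin sqr_ge0.
have mu2 : measurable_fun setT (fun y => (u y ^+ 2)%:E).
  by apply/measurable_EFinP; exact: measurable_funX.
have mQ2 := measurable_fun_integral_kernel (@measurable_kernel _ _ _ _ _ Q) u20 mu2.
apply: (@le_integrable _ _ _ _ _ measurableT _
    ((fun x => (f x ^+ 2)%:E) \+ (fun x => \int[Q x]_y (u y ^+ 2)%:E))%E).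
- apply/measurable_EFinP; apply: measurable_funM => //.
  exact: measurable_Kop.
- move=> x _ /=; rewrite [leRHS]gee0_abs; last first.
    by rewrite adde_ge0// ?lee_fin ?sqr_ge0 ?integral_ge0.
  rewrite normrM EFinM.
  apply: (@le_trans _ _ (`|f x|%:E * \int[Q x]_y `|(u y)%:E|)%E).
    rewrite muleC lee_wpmul2l// /Kop /Rintegral.
    apply: le_trans (le_abse_integral _ _ _) => //; last exact/measurable_EFinP.
    (* [fine] sends an infinite integral to 0, so the bound holds in that case too. *)
    by case: (integral _ _ _) => //= *; rewrite ?normr0 ?leey// leNye.
  rewrite -ge0_integralZl//.
  apply: (@le_trans _ _ (\int[Q x]_y ((f x ^+ 2)%:E + (u y ^+ 2)%:E))%E).
    apply: ge0_le_integral => //.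
    + exact: measurable_funeM.
    + exact: emeasurable_funD.
    + move=> y _; rewrite /= lee_fin -normrM.
      rewrite ler_norml; have := sqr_ge0 (f x); have := sqr_ge0 (u y).
      have := sqr_ge0 (f x - u y); have := sqr_ge0 (f x + u y).
      by nra.
  rewrite ge0_integralD// ?integral_cst// ?lee_fin ?sqr_ge0//.
  by rewrite prob_kernel mule1.
- apply: integrableD => //; first exact: Lfun2_integrable_sqr.
  apply/integrableP; split => //.
  under eq_integral do rewrite gee0_abs ?integral_ge0//.
  rewrite inv//; have /integrableP[_] := Lfun2_integrable_sqr u2.
  apply: le_lt_trans; rewrite le_eqVlt; apply/orP; left; apply/eqP.
  by apply: eq_integral => x _; rewrite /= ger0_norm ?sqr_ge0.
Qed.

End invariant_kernel.

Lemma Lfun2_le d (T : measurableType d) (R : realType) (mu : probability T R)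
  (f g : T -> R) : measurable_fun setT g -> (forall x, `|g x| <= `|f x|) ->
  f \in Lfun mu 2%:E -> g \in Lfun mu 2%:E.
Proof.
move=> mg gf f2; have mf := Lfun2_mfun f2.
rewrite inE; apply/andP; split; rewrite inE//=.
have : f \in finLfun mu 2%:E by exact: sub_Lfun_finLfun.
rewrite inE/=; apply: le_lt_trans.
have mpow (k : T -> R) : measurable_fun setT k ->
    measurable_fun setT (fun x => (`|k x| `^ 2)%:E).
  move=> mk; apply/measurable_EFinP.
  by apply: (measurableT_comp (measurable_powR _)); exact: measurableT_comp.
rewrite unlock; apply: gt0_ler_poweR => //; rewrite ?in_itv/= ?leey ?andbT.
- by apply: integral_ge0 => x _; rewrite lee_fin powR_ge0.
- by apply: integral_ge0 => x _; rewrite lee_fin powR_ge0.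
- apply: ge0_le_integral => //; [exact: mpow..|].
  by move=> x _; rewrite lee_fin ge0_ler_powR.
Qed.

Section time_reversal_dot.
Context d (T : measurableType d) (R : realType) (mu : probability T R).
Implicit Types u f g : T -> R.

Lemma dotC f g : dot mu f g = dot mu g f.
Proof. by apply: eq_Rintegral => x _; rewrite mulrC. Qed.

Lemma ae_eq_dot f f' g : measurable_fun setT f -> measurable_fun setT f' ->
  measurable_fun setT g -> f = f' %[ae mu] -> dot mu f g = dot mu f' g.
Proof.
move=> mf mf' mg ff'; congr fine; apply: ae_eq_integral => //.
- by apply/measurable_EFinP; exact: measurable_funM.
- by apply/measurable_EFinP; exact: measurable_funM.
- by apply: filterS ff' => x ff' _; rewrite ff'.
Qed.

Lemma dotBl f f' g : mu.-integrable setT (EFin \o (f \* g)) ->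
  mu.-integrable setT (EFin \o (f' \* g)) ->
  dot mu (f \- f') g = dot mu f g - dot mu f' g.
Proof.
move=> fg f'g; rewrite /dot -RintegralB//.
by apply: eq_Rintegral => x _ /=; rewrite mulrBl.
Qed.

Variables Q Q' : R.-pker T ~> T.

Definition dual_dot u f := dot mu (Kop Q u) f = dot mu u (Kop Q' f).

Hypothesis rev : time_reversal mu Q Q'.

Let inv := time_reversal_invariant rev.
Let inv' := time_reversal_invariant (time_reversal_sym rev).

Let KopE (L : R.-pker T ~> T) u :
  (forall v : T -> \bar R, (forall x, 0 <= v x)%E -> measurable_fun setT v ->
    (\int[mu]_x \int[L x]_y v y = \int[mu]_x v x)%E) ->
  u \in Lfun mu 2%:E ->
  {ae mu, forall x, (Kop L u x)%:E = \int[L x]_y (u y)%:E}%E.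
Proof.
move=> invL u2; apply: filterS (integrable_kernel_ae invL (Lfun2_integrable u2)) => x ux.
by rewrite /Kop /Rintegral fineK// integrable_fin_num.
Qed.

(** For nonnegative arguments the extended-real identity applies directly; [Kop] differs from the
    extended-real integral only on a null set. *)
Lemma dual_dot_ge0 u f : (forall x, 0 <= u x) -> (forall x, 0 <= f x) ->
  u \in Lfun mu 2%:E -> f \in Lfun mu 2%:E -> dual_dot u f.
Proof.
move=> u0 f0 u2 f2; have mf := Lfun2_mfun f2; have mu_ := Lfun2_mfun u2.
have meu : measurable_fun setT (EFin \o u) by exact/measurable_EFinP.
have mef : measurable_fun setT (EFin \o f) by exact/measurable_EFinP.
have u0e x : (0 <= (EFin \o u) x)%E by rewrite lee_fin.
have f0e x : (0 <= (EFin \o f) x)%E by rewrite lee_fin.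
have mK := measurable_fun_integral_kernel (@measurable_kernel _ _ _ _ _ Q) u0e meu.
have mK' := measurable_fun_integral_kernel (@measurable_kernel _ _ _ _ _ Q') f0e mef.
congr fine.
transitivity (\int[mu]_x ((EFin \o f) x * \int[Q x]_y (EFin \o u) y))%E.
  apply: ae_eq_integral => //.
  - apply/measurable_EFinP; apply: measurable_funM => //.
    exact: measurable_Kop.
  - exact: emeasurable_funM.
  - by apply: filterS (KopE inv u2) => x E _; rewrite EFinM E muleC.
rewrite (time_reversal_integral rev)//; apply: ae_eq_integral => //.
- exact: emeasurable_funM.
- apply/measurable_EFinP; apply: measurable_funM => //.
  exact: measurable_Kop.
- by apply: filterS (KopE inv' f2) => x E _; rewrite EFinM E.
Qed.

Lemma dual_dotBl u u' f : u \in Lfun mu 2%:E -> u' \in Lfun mu 2%:E ->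
  f \in Lfun mu 2%:E -> dual_dot u f -> dual_dot u' f -> dual_dot (u \- u') f.
Proof.
move=> u2 u'2 f2 uf u'f; have mf := Lfun2_mfun f2; have mu_ := Lfun2_mfun u2.
have mu' := Lfun2_mfun u'2; rewrite /dual_dot.
rewrite (ae_eq_dot _ _ _ (KopB_ae inv _ _))//; do ?exact: Lfun2_integrable.
- rewrite dotBl ?uf ?u'f; do ?exact: integrable_Kop_mul.
  rewrite dotBl//.
  + by have := integrable_Kop_mul inv' u2 f2; apply: eq_integrable => // x _; rewrite /= mulrC.
  + by have := integrable_Kop_mul inv' u'2 f2; apply: eq_integrable => // x _; rewrite /= mulrC.
- by apply: measurable_Kop; exact: measurable_funB.
- by apply: measurable_funB; exact: measurable_Kop.
Qed.
End time_reversal_dot.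

(** Bilinearity reduces the claim to nonnegative functions. Subtraction is available in the left
    argument only; since the reversal relation is symmetric, [swap] exchanges the roles and covers
    the right one. *)
Lemma time_reversal_dot d (T : measurableType d) (R : realType)
    (mu : probability T R) (Q Q' : R.-pker T ~> T) (u f : T -> R) :
    time_reversal mu Q Q' -> u \in Lfun mu 2%:E -> f \in Lfun mu 2%:E ->
  dot mu (Kop Q u) f = dot mu u (Kop Q' f).
Proof.
move=> rev u2 f2.
have swap L L' (v g : T -> R) : dual_dot mu L' L g v -> dual_dot mu L L' v g.
  by rewrite /dual_dot dotC => ->; rewrite dotC.
have n2 (g : T -> R) : g \in Lfun mu 2%:E -> Num.norm \o g \in Lfun mu 2%:E.
  move=> g2; apply: (@Lfun2_le _ _ _ _ g) => //; last by move=> x; rewrite /= normr_id.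
  by apply: measurableT_comp => //; exact: Lfun2_mfun g2.
have b2 (g : T -> R) : g \in Lfun mu 2%:E -> (Num.norm \o g) \- g \in Lfun mu 2%:E.
  move=> g2; apply: (@Lfun2_le _ _ _ _ (2 \o* g)).
  - apply: measurable_funB; last exact: Lfun2_mfun g2.
    by apply: measurableT_comp => //; exact: Lfun2_mfun g2.
  - by move=> x /=; rewrite (le_trans (ler_normB _ _))// normrM normr_nat normr_id mulr_natr mulr2n.
  - by apply: Lfun_scale => //; rewrite ler1n.
(* Both |g| and |g| - g are nonnegative and bounded by 2|g|, hence in L^2. *)
have splitE (g : T -> R) : g = (Num.norm \o g) \- ((Num.norm \o g) \- g).
  by apply/funext => x /=; rewrite opprB addrCA subrr addr0.
have ge0 L L' (v g : T -> R) : time_reversal mu L L' -> (forall x, 0 <= v x) ->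
    v \in Lfun mu 2%:E -> g \in Lfun mu 2%:E -> dual_dot mu L L' v g.
  move=> r v0 v2 g2; apply: swap; rewrite (splitE g).
  apply: dual_dotBl; do ?[exact: n2|exact: b2|exact: v2|exact: time_reversal_sym].
    by apply: (dual_dot_ge0 (time_reversal_sym r)) => //; [move=> x /=|exact: n2].
  apply: (dual_dot_ge0 (time_reversal_sym r)) => //; last exact: b2.
  by move=> x /=; rewrite subr_ge0 ler_norm.
rewrite -/(dual_dot mu Q Q' u f) (splitE u).
apply: (dual_dotBl rev); do ?[exact: n2|exact: b2|exact: f2].
  by apply: ge0 => //; [move=> x /=|exact: n2].
by apply: ge0 => //; [move=> x /=; rewrite subr_ge0 ler_norm|exact: b2].
Qed.

(** * Kernels of the window chain *)

(** The sides are indexed by [nat] so that they can be shifted by [A \o S] and shared with cylinders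
    of any length. *)
Definition tuple_box (T : Type) (n : nat) (A : nat -> set T) : set (n.-tuple T) :=
  [set x | forall i, A (val i) (tnth x i)].
Arguments tuple_box {T} n A.

Section tuple_box.
Context d (T : measurableType d) (R : realType) (n : nat).

Lemma measurable_tuple_box (A : nat -> set T) :
  (forall i, measurable (A i)) -> measurable (tuple_box n A).
Proof.
move=> mA.
rewrite (_ : tuple_box n A = \bigcap_(i in [set: 'I_n]) ((@tnth n T)^~ i @^-1` A (val i))).
  apply: fin_bigcap_measurable => // i _.
  by rewrite -[X in measurable X]setTI; exact: measurable_tnth.
by apply/seteqP; split => [x Ax i _|x Ax i]; exact: Ax.
Qed.

(** Boxes are stable under intersection and generate the product sigma-algebra. *)
Lemma tuple_box_measure_unique (m1 m2 : {measure set (n.-tuple T) -> \bar R}) :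
  (m1 setT < +oo)%E ->
  (forall A : nat -> set T, (forall i, measurable (A i)) ->
    m1 (tuple_box n A) = m2 (tuple_box n A)) ->
  forall B, measurable B -> m1 B = m2 B.
Proof.
move=> m1oo m12 B mB.
pose G := [set C | exists2 A : nat -> set T, (forall i, measurable (A i)) &
                   C = tuple_box n A].
have GT : G setT.
  by exists (fun=> setT) => //; apply/seteqP; split.
apply: (measure_unique G (fun=> setT)) => //.
- apply/seteqP; split.
    apply: smallest_sub; first exact: smallest_sigma_algebra.
    rewrite -bigcup_seq => C [i _] [D mD <-]; apply: sub_sigma_algebra.
    (* The preimage of D under one coordinate is the box whose other sides are the whole space. *)
    exists (fun j => if j == val i then D else setT).
      by move=> j; case: ifP.
    rewrite setTI; apply/seteqP; split => [x /= Dx j|x /(_ i)]; last by rewrite eqxx.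
    by case: eqP => // /val_inj ->.
  apply: smallest_sub; first exact: sigma_algebra_measurable.
  by move=> C [A mA ->]; exact: measurable_tuple_box.
- move=> _ _ [A mA ->] [A' mA' ->]; exists (fun i => A i `&` A' i).
    by move=> i; exact: measurableI.
  apply/seteqP; split => [x [Ax A'x] i|x Ax]; first by split; [exact: Ax|exact: A'x].
  by split => i; have [] := Ax i.
- by rewrite bigcup_const.
- by move=> _ [A mA ->]; exact: m12.
Qed.

End tuple_box.

Section kernel_pull.
Context d d' d'' (S : measurableType d) (E : measurableType d')
  (T : measurableType d'') (R : realType).
Variables (K : R.-pker E ~> T) (phi : S -> E).

(** Measurability of [phi] is an argument so that the kernel instance can be attached to the
    function itself. *)
Definition kpull (mphi : measurable_fun setT phi) (x : S) :
  {measure set T -> \bar R} := K (phi x).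

Hypothesis mphi : measurable_fun setT phi.

Let measurable_kpull U : measurable U ->
  measurable_fun setT (kpull mphi ^~ U).
Proof.
by move=> mU; exact: (measurableT_comp (measurable_kernel K U mU) mphi).
Qed.

HB.instance Definition _ := isKernel.Build _ _ _ _ _ (kpull mphi) measurable_kpull.

Let kpull_prob x : kpull mphi x setT = 1%E.
Proof. exact: prob_kernel. Qed.

HB.instance Definition _ := Kernel_isProbability.Build _ _ _ _ _
  (kpull mphi) kpull_prob.

End kernel_pull.

Section kernel_map.
Local Open Scope ereal_scope.
Context d d' d'' (S : measurableType d) (E : measurableType d')
  (T : measurableType d'') (R : realType).
Variables (K : R.-pker S ~> E) (sigma : S * E -> T).

(** The law of sigma(x, z) for z drawn from [K x], written as a composition with a Dirac kernel so
    that the kernel structure is inherited. *)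
Definition kmap (msigma : measurable_fun setT sigma) : S -> {measure set T -> \bar R} :=
  mkcomp K (kdirac msigma).

Hypothesis msigma : measurable_fun setT sigma.

HB.instance Definition _ := Kernel.on (kmap msigma).

Lemma integral_kmap x f : (forall z, 0 <= f z) -> measurable_fun setT f ->
  \int[kmap msigma x]_z f z = \int[K x]_z f (sigma (x, z)).
Proof.
move=> f0 mf; rewrite /kmap /mkcomp/= integral_kcomp//.
by apply: eq_integral => z _; rewrite integral_dirac// diracT mul1e.
Qed.

Lemma kmapE x A : measurable A -> kmap msigma x A = K x [set z | A (sigma (x, z))].
Proof.
move=> mA; have ms := measurableT_comp msigma (pair1_measurable x).
rewrite /kmap /mkcomp/= /kcomp /kdirac.
have mB : measurable [set z | A (sigma (x, z))].
  by rewrite -[X in measurable X]setTI; exact: ms.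
by rewrite -[X in _ = K x X]setIT -integral_indic.
Qed.

Let kmap_prob x : kmap msigma x setT = 1%E.
Proof. by rewrite kmapE// prob_kernel. Qed.

HB.instance Definition _ := Kernel_isProbability.Build _ _ _ _ _
  (kmap msigma) kmap_prob.

(** Positive and negative parts are transported separately, which also covers a non-integrable f.
    This is why [PkE] holds at every window and not just almost everywhere. *)
Lemma Rintegral_kmap x f : measurable_fun setT f ->
  (\int[kmap msigma x]_z f z = \int[K x]_z f (sigma (x, z)))%R.
Proof.
move=> mf; congr fine; rewrite integralE [RHS]integralE; congr (_ - _).
  rewrite integral_kmap//.
    by apply: eq_integral => z _; rewrite !funeposE.
  by apply: measurable_funepos; exact/measurable_EFinP.
rewrite integral_kmap//.
  by apply: eq_integral => z _; rewrite !funenegE.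
by apply: measurable_funeneg; exact/measurable_EFinP.
Qed.

End kernel_map.

Section window_kernels.
Context dE (E : measurableType dE) (R : realType) (K : R.-pker E ~> E) (k : nat).

Lemma measurable_nth i : measurable_fun setT (fun x : k.-tuple E => nth point x i).
Proof.
have [ik|ki] := ltnP i k; last first.
  rewrite (_ : (fun _ => _) = cst point); first exact: measurable_cst.
  by apply/funext => x; rewrite nth_default// size_tuple.
rewrite (_ : (fun _ => _) = (@tnth k E)^~ (Ordinal ik)); first exact: measurable_tnth.
by apply/funext => x; rewrite (tnth_nth point).
Qed.

Lemma measurable_shift_window :
  measurable_fun setT (fun xz : k.-tuple E * E => shift_window xz.1 xz.2).
Proof.
apply/measurable_fun_tnthP => i; have [ik|ki] := ltnP i.+1 k.
  rewrite (_ : _ \o _ = (fun x : k.-tuple E => nth point x i.+1) \o fst).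
    by apply: measurableT_comp => //; exact: measurable_nth.
  apply/funext => x /=; rewrite tnth_mktuple; apply: set_nth_default.
  by rewrite size_tuple.
rewrite (_ : _ \o _ = snd)//; apply/funext => x /=.
by rewrite tnth_mktuple nth_default// size_tuple.
Qed.

Definition unshift_window (x : k.-tuple E) (z : E) : k.-tuple E :=
  [tuple nth point (z :: x) i | i < k].

Lemma measurable_unshift_window :
  measurable_fun setT (fun xz : k.-tuple E * E => unshift_window xz.1 xz.2).
Proof.
apply/measurable_fun_tnthP => -[[|i] ik].
  by rewrite (_ : _ \o _ = snd)//; apply/funext => x /=; rewrite tnth_mktuple.
rewrite (_ : _ \o _ = (fun x : k.-tuple E => nth point x i) \o fst).
  by apply: measurableT_comp => //; exact: measurable_nth.
by apply/funext => x /=; rewrite tnth_mktuple.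
Qed.

Definition forward_kernel : R.-pker k.-tuple E ~> k.-tuple E :=
  kmap (kpull K (measurable_nth k.-1)) measurable_shift_window.

(** The predecessor of x_1 is drawn from [K] itself, which is its own time-reversal when the chain
    is reversible. *)
Definition backward_kernel : R.-pker k.-tuple E ~> k.-tuple E :=
  kmap (kpull K (measurable_nth 0)) measurable_unshift_window.

Lemma PkE f : measurable_fun setT f -> Pk K f = Kop forward_kernel f.
Proof. by move=> mf; apply/funext => x; rewrite /Kop Rintegral_kmap. Qed.

Lemma Kop_backward f x : measurable_fun setT f ->
  Kop backward_kernel f x = \int[K (nth point x 0)]_z f (unshift_window x z).
Proof. by move=> mf; rewrite /Kop Rintegral_kmap. Qed.

End window_kernels.

(** * Finite-dimensional laws of the Markov chain *)

Section markov_chain.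
Local Open Scope ereal_scope.
Context (R : realType) dE (E : measurableType dE) dO (Omega : measurableType dO).
Context (P : probability Omega R) (X : int -> {RV P >-> E}).
Context (nu : probability E R) (K : R.-pker E ~> E).
Hypothesis chain : stationary_markov_chain nu K X.

Let measurable_X t A : measurable A -> measurable (X t @^-1` A).
Proof. by move=> mA; rewrite -[X in measurable X]setTI; exact: measurable_funPT. Qed.

Lemma past_measurable t : past X t `<=` measurable.
Proof.
apply: smallest_sub; first exact: sigma_algebra_measurable.
by move=> _ [s [A [_ mA ->]]]; exact: measurable_X.
Qed.

Lemma past_le s t : (s <= t)%R -> past X s `<=` past X t.
Proof.
move=> st; apply: smallest_sub; first exact: smallest_sigma_algebra.
move=> _ [r [A [rs mA ->]]]; apply: sub_sigma_algebra.
by exists r, A; split=> //; exact: le_trans st.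
Qed.

Lemma past_preimage s t A : (s <= t)%R -> measurable A -> past X t (X s @^-1` A).
Proof. by move=> st mA; apply: sub_sigma_algebra; exists s, A. Qed.

Lemma pastI t : setI_closed (past X t).
Proof. by move=> A B; exact: (@measurableI _ (g_sigma_algebraType _)). Qed.

Lemma marginal_integral t (f : E -> \bar R) :
  (forall x, 0 <= f x) -> measurable_fun setT f ->
  \int[P]_w f (X t w) = \int[nu]_x f x.
Proof.
move=> f0 mf; case: chain => _ marg _.
rewrite [RHS](eq_measure_integral (distribution P (X t))).
  by rewrite ge0_integral_pushforward.
move=> A mA _. by apply/esym/marg.
Qed.

(** The Markov property says that two mixtures with weight [\1_B], one of Dirac masses at X_{t+1}
    and one of the laws [K (X t w)], agree on sets. *)
Lemma markov_integral t B (f : E -> \bar R) : past X t B ->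
  (forall x, 0 <= f x) -> measurable_fun setT f ->
  \int[P]_(w in B) f (X (t + 1) w) = \int[P]_(w in B) \int[K (X t w)]_y f y.
Proof.
move=> pB f0 mf; case: chain => _ _ markov.
have mB := past_measurable pB.
have B0 w : 0 <= (\1_B w)%:E :> \bar R by rewrite lee_fin.
have m1B : measurable_fun setT (fun w => (\1_B w)%:E : \bar R).
  exact/measurable_EFinP.
have mX s : measurable_fun setT (X s) by exact: measurable_funPT.
rewrite integral_indicl [RHS]integral_indicl.
transitivity (\int[mixture P (kdirac (mX (t + 1)%R)) B0 m1B]_y f y).
  rewrite integral_mixture//; apply: eq_integral => w _.
  by rewrite integral_dirac// diracT mul1e.
rewrite (eq_measure_integral (mixture P (kpull K (mX t)) B0 m1B)).
  by rewrite integral_mixture.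
move=> A mA _; transitivity (\int[P]_(w in B) K (X t w) A); last first.
  by rewrite integral_indicl.
rewrite -markov//; transitivity (\int[P]_(w in B) (\1_(X (t + 1)%R @^-1` A) w)%:E).
  by rewrite integral_indicl.
by rewrite setIC integral_indic//; exact: measurable_X.
Qed.

(* cylinder_prob A n x = P_x(X_1 \in A 0, ..., X_n \in A (n - 1)) *)
Fixpoint cylinder_prob (A : nat -> set E) (n : nat) (x : E) : \bar R :=
  if n is m.+1 then
    \int[K x]_y ((\1_(A 0%N) y)%:E * cylinder_prob (A \o S) m y)
  else 1.

Lemma cylinder_prob_ge0 A n x : 0 <= cylinder_prob A n x.
Proof.
elim: n A x => [|n IH] A x //=.
by apply: integral_ge0 => y _; rewrite mule_ge0// lee_fin.
Qed.

Lemma measurable_cylinder_prob A n : (forall i, measurable (A i)) ->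
  measurable_fun setT (cylinder_prob A n).
Proof.
elim: n A => [|n IH] A mA /=; first exact: measurable_cst.
apply: (measurable_fun_integral_kernel (@measurable_kernel _ _ _ _ _ K)).
  by move=> y; rewrite mule_ge0// ?lee_fin// cylinder_prob_ge0.
apply: emeasurable_funM; first exact/measurable_EFinP.
by apply: IH => i; exact: mA.
Qed.

Definition cylinder (A : nat -> set E) (n : nat) (t : int) : set Omega :=
  [set w | forall i, (i < n)%N -> A i (X (t + i.+1%:Z) w)].

Lemma cylinderS A n t :
  cylinder A n.+1 t = X (t + 1) @^-1` A 0%N `&` cylinder (A \o S) n (t + 1).
Proof.
apply/seteqP; split => [w Aw|w [A0 Aw] [|i] ni//].
  split=> [|i ni]; first exact: Aw 0%N _.
  by have := Aw i.+1 ni; rewrite -addrA.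
by have := Aw i ni; rewrite -addrA.
Qed.

Lemma measurable_cylinder A n t : (forall i, measurable (A i)) ->
  measurable (cylinder A n t).
Proof.
elim: n A t => [|n IH] A t mA.
  by rewrite (_ : cylinder _ _ _ = setT)//; apply/seteqP; split.
rewrite cylinderS; apply: measurableI; first exact: measurable_X.
by apply: IH => i; exact: mA.
Qed.

(** Peel off the first side: the event that X_{t+1} is in [A 0] joins B in the past of t + 1, and
    the one-step Markov property brings the resulting integral back to time t. *)
Lemma cylinderE A n t B : (forall i, measurable (A i)) -> past X t B ->
  P (B `&` cylinder A n t) = \int[P]_(w in B) cylinder_prob A n (X t w).
Proof.
elim: n A t B => [|n IH] A t B mA pB.
  rewrite (_ : cylinder _ _ _ = setT); last by apply/seteqP; split.
  by rewrite setIT integral_cst ?mul1e//; exact: past_measurable pB.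
have mAS i : measurable ((A \o S) i) by exact: mA.
rewrite cylinderS setIA IH//; last first.
  apply: pastI; last exact: past_preimage.
  by apply: past_le pB; rewrite lerDl.
rewrite integral_mkcondr/= -markov_integral//.
- apply: eq_integral => w _; rewrite epatch_indic/= muleC; congr (_ * _).
- by move=> y; rewrite mule_ge0// ?lee_fin// cylinder_prob_ge0.
- apply: emeasurable_funM; first exact/measurable_EFinP.
  exact: measurable_cylinder_prob.
Qed.

(** For g an indicator this is [cylinderE] with an event on X_t as past; both sides are integrals of
    g against measures, so every nonnegative g follows. *)
Lemma cylinder_weight A n t (g : E -> \bar R) : (forall i, measurable (A i)) ->
  (forall x, 0 <= g x) -> measurable_fun setT g ->
  \int[P]_(w in cylinder A n t) g (X t w) =
  \int[nu]_x (cylinder_prob A n x * g x).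
Proof.
move=> mA g0 mg.
have mX : measurable_fun setT (X t) by exact: measurable_funPT.
have mC := measurable_cylinder n t mA.
have C0 w : 0 <= (\1_(cylinder A n t) w)%:E :> \bar R by rewrite lee_fin.
have m1C : measurable_fun setT (fun w => (\1_(cylinder A n t) w)%:E : \bar R).
  exact/measurable_EFinP.
have G0 w : 0 <= cylinder_prob A n (X t w) by exact: cylinder_prob_ge0.
have mG : measurable_fun setT (fun w => cylinder_prob A n (X t w)).
  by apply: measurableT_comp => //; exact: measurable_cylinder_prob.
rewrite -(marginal_integral t); first last.
- by apply: emeasurable_funM => //; exact: measurable_cylinder_prob.
- by move=> x; rewrite mule_ge0// cylinder_prob_ge0.
rewrite integral_indicl.
transitivity (\int[mixture P (kdirac mX) C0 m1C]_y g y).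
  rewrite integral_mixture//; apply: eq_integral => w _.
  by rewrite integral_dirac// diracT mul1e.
rewrite (eq_measure_integral (mixture P (kdirac mX) G0 mG)).
  rewrite integral_mixture//; apply: eq_integral => w _.
  by rewrite integral_dirac// diracT mul1e.
move=> D mD _.
transitivity (\int[P]_(w in cylinder A n t) (\1_(X t @^-1` D) w)%:E).
  by rewrite [RHS]integral_indicl.
transitivity (P (X t @^-1` D `&` cylinder A n t)).
  by rewrite integral_indic//; exact: measurable_X.
rewrite cylinderE//; last exact: past_preimage.
by rewrite integral_indicl; apply: eq_integral => w _; rewrite muleC.
Qed.

End markov_chain.

Section mixture_box.
Local Open Scope ereal_scope.
Context d d' dE (T : measurableType d) (Omega : measurableType d')
  (E : measurableType dE) (R : realType) (n : nat).
Variables (m : {measure set T -> \bar R}) (P : probability Omega R).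

(** For a fixed event D both sides are finite measures in B. In a mass formula this lets one
    argument be a box while the other stays arbitrary. *)
Lemma mixture_box_unique (g : T -> \bar R) (L : R.-pker T ~> n.-tuple E)
    (W : Omega -> n.-tuple E) (D : set Omega) :
    (forall x, 0 <= g x) -> measurable_fun setT g ->
    measurable_fun setT W -> measurable D ->
    (forall B : nat -> set E, (forall i, measurable (B i)) ->
      \int[m]_x (g x * L x (tuple_box n B)) = P (D `&` W @^-1` tuple_box n B)) ->
  forall B, measurable B -> \int[m]_x (g x * L x B) = P (D `&` W @^-1` B).
Proof.
move=> g0 mg mW mD gLW B mB.
have D0 w : 0 <= (\1_D w)%:E :> \bar R by rewrite lee_fin.
have m1D : measurable_fun setT (fun w => (\1_D w)%:E : \bar R).
  exact/measurable_EFinP.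
have DE C : measurable C ->
    mixture P (kdirac mW) D0 m1D C = P (D `&` W @^-1` C).
  move=> mC; have mWC : measurable (W @^-1` C).
    by rewrite -[X in measurable X]setTI; exact: mW.
  transitivity (\int[P]_(w in D) (\1_(W @^-1` C) w)%:E).
    by rewrite [RHS]integral_indicl.
  by rewrite integral_indic// setIC.
rewrite -DE//; apply: (tuple_box_measure_unique (m1 := mixture m L g0 mg)) => //.
  rewrite -[ltLHS]/(\int[m]_x (g x * L x setT)).
  have := gLW (fun=> setT) (fun=> measurableT).
  rewrite (_ : tuple_box n _ = setT); last by apply/seteqP; split.
  move=> ->; apply: le_lt_trans (ltry 1); apply: probability_le1.
  by rewrite preimage_setT setIT.
move=> A mA; apply: (eq_trans (gLW A mA)).
by apply/esym/DE; exact: measurable_tuple_box.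
Qed.

End mixture_box.

(** * Time reversal of the window kernels under the window law *)

Section window_time_reversal.
Local Open Scope ereal_scope.
Context (R : realType) dE (E : measurableType dE) dO (Omega : measurableType dO).
Context (P : probability Omega R) (X : int -> {RV P >-> E}).
Context (nu : probability E R) (K : R.-pker E ~> E) (n : nat).
Hypothesis chain : stationary_markov_chain nu K X.
Hypothesis revK : reversible nu K.

Let W0 := window X n.+1.
Let W1 (w : Omega) : n.+1.-tuple E := [tuple X i.+2%:Z w | i < n.+1].
Let pi := window_law X n.+1.

Let measurable_X t A : measurable A -> measurable (X t @^-1` A).
Proof. by move=> mA; rewrite -[X in measurable X]setTI; exact: measurable_funPT. Qed.

Let mW0 : measurable_fun setT W0.
Proof. exact: measurable_window. Qed.

Let mW1 : measurable_fun setT W1.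
Proof.
apply/measurable_fun_tnthP => i.
rewrite (_ : _ \o _ = X i.+2%:Z) ?measurable_funPT//.
by apply/funext => w /=; rewrite tnth_mktuple.
Qed.

Let measurable_W0 A : measurable A -> measurable (W0 @^-1` A).
Proof. by move=> mA; rewrite -[X in measurable X]setTI; exact: mW0. Qed.

Let measurable_W1 A : measurable A -> measurable (W1 @^-1` A).
Proof. by move=> mA; rewrite -[X in measurable X]setTI; exact: mW1. Qed.

Let nth_W0 i w : (i < n.+1)%N -> nth point (W0 w) i = X i.+1%:Z w.
Proof. by move=> ik; rewrite -(tnth_nth _ (W0 w) (Ordinal ik)) tnth_mktuple. Qed.

Lemma past_window A : measurable A -> past X n.+1 (W0 @^-1` A).
Proof.
(* [Omega] is given the sigma-algebra of the past, so that measurability of the window can be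
   checked one coordinate at a time. *)
move=> mA; pose T := g_sigma_algebraType
  [set B | exists s C, [/\ (s <= n.+1%:Z)%R, measurable C & B = X s @^-1` C]].
suff mW : measurable_fun [set: T] (W0 : T -> n.+1.-tuple E).
  by have := mW measurableT A mA; rewrite setTI.
apply/measurable_fun_tnthP => i _ C mC; rewrite setTI.
apply: sub_sigma_algebra; exists i.+1%:Z, C; split => //.
  by rewrite lez_nat.
by apply/seteqP; split => w /=; rewrite tnth_mktuple.
Qed.

Lemma window_law_integral (f : n.+1.-tuple E -> \bar R) :
  (forall x, 0 <= f x) -> measurable_fun setT f ->
  \int[pi]_x f x = \int[P]_w f (W0 w).
Proof.
by move=> f0 mf; rewrite /pi /window_law ge0_integral_pushforward.
Qed.

Lemma window_law_integral_in A (f : n.+1.-tuple E -> \bar R) : measurable A ->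
  (forall x, 0 <= f x) -> measurable_fun setT f ->
  \int[pi]_(x in A) f x = \int[P]_(w in W0 @^-1` A) f (W0 w).
Proof.
move=> mA f0 mf; rewrite /pi /window_law ge0_integral_pushforward//.
exact: measurable_funTS.
Qed.

Lemma window_marginal i (f : E -> \bar R) : (i < n.+1)%N ->
  (forall x, 0 <= f x) -> measurable_fun setT f ->
  \int[pi]_x f (nth point x i) = \int[nu]_x f x.
Proof.
move=> ik f0 mf; rewrite window_law_integral//; last first.
  exact: (measurableT_comp mf (measurable_nth i)).
rewrite -(marginal_integral chain i.+1%:Z f0 mf).
by apply: eq_integral => w _; rewrite nth_W0.
Qed.

(** Separates what a box demands of the old window from what it demands of the new entry, so that
    the kernel mass of a box is an indicator times a mass of [K]. *)
Let shift_box x z (B : nat -> set E) :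
  tuple_box n.+1 B (shift_window x z) <->
  (forall i : 'I_n, B i (nth point x i.+1)) /\ B n z.
Proof.
split.
  move=> Bx; split=> [i|].
    have := Bx (widen_ord (leqnSn n) i); rewrite tnth_mktuple/=.
    by rewrite (set_nth_default point)// size_tuple ltnS.
  by have := Bx ord_max; rewrite tnth_mktuple/= nth_default// size_tuple.
move=> [Bx Bz] i; rewrite tnth_mktuple/=.
have [ik|] := ltnP i n; last first.
  move=> ni; have -> : val i = n by apply/eqP; rewrite eqn_leq ni -ltnS ltn_ord.
  by rewrite nth_default// size_tuple.
by rewrite (set_nth_default point) ?size_tuple ?ltnS//; exact: (Bx (Ordinal ik)).
Qed.

Let unshift_box (x : n.+1.-tuple E) z (A : nat -> set E) :
  tuple_box n.+1 A (unshift_window x z) <->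
  A 0%N z /\ (forall i : 'I_n, A i.+1 (nth point x i)).
Proof.
split.
  move=> Ax; split=> [|i]; first by have := Ax ord0; rewrite tnth_mktuple.
  by have := Ax (lift ord0 i); rewrite tnth_mktuple.
move=> [Az Ax] [[|i] ik]; rewrite tnth_mktuple//=.
exact: (Ax (Ordinal (ik : (i < n)%N))).
Qed.

(** For a box B, all sides but the last constrain entries already in the window and are absorbed
    into A; what is left is one Markov step from time n + 1, the last time of the window. *)
Let forward_mass A B : measurable A -> measurable B ->
  \int[pi]_(x in A) forward_kernel K n.+1 x B = P (W0 @^-1` A `&` W1 @^-1` B).
Proof.
move=> mA mB; set Q := forward_kernel _ _.
rewrite integral_indicl; apply: mixture_box_unique => //; first exact/measurable_EFinP.
  exact: measurable_W0.
move=> {mB} {}B mB; have mboxB : measurable (tuple_box n.+1 B).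
  exact: measurable_tuple_box.
rewrite -integral_indicl.
pose A' := A `&` [set x | forall i : 'I_n, B i (nth point x i.+1)].
have mA' : measurable A'.
  apply: measurableI => //.
  rewrite (_ : [set _ | _] = \bigcap_(i in [set: 'I_n])
      ((fun x => nth point x i.+1) @^-1` B i)).
    apply: fin_bigcap_measurable => // i _.
    by rewrite -[X in measurable X]setTI; exact: measurable_nth.
  by apply/seteqP; split => [x Bx i _|x Bx i]; exact: Bx.
have mKn : measurable_fun setT (fun x : n.+1.-tuple E => K (nth point x n) (B n)).
  exact: (measurableT_comp (measurable_kernel K _ (mB n)) (measurable_nth n)).
transitivity (\int[pi]_(x in A') K (nth point x n) (B n)).
  rewrite integral_mkcondr; apply: eq_integral => x _.
  rewrite patchE /Q/= kmapE; last exact: measurable_tuple_box.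
  case: ifPn => [|]; rewrite ?inE ?notin_setE => Bx.
    congr (K _ _); apply/seteqP; split => z /=; first by move=> /shift_box[].
    by move=> Bz; apply/shift_box.
  rewrite (_ : [set _ | _] = set0) ?measure0//; apply/seteqP; split => // z /=.
  by move=> /shift_box[].
rewrite window_law_integral_in//.
case: (chain) => _ _ markov.
transitivity (P (W0 @^-1` A' `&` X (n.+1%:Z + 1) @^-1` B n)).
  rewrite markov//; last exact: past_window.
  by apply: eq_integral => w _; rewrite nth_W0.
congr (P _); rewrite /A' preimage_setI -setIA; congr (_ `&` _).
have XS : (n.+1%:Z + 1)%R = n.+2%:Z by rewrite -PoszD addn1.
rewrite XS; apply/seteqP; split => w.
  move=> [Bw Bn] i; rewrite tnth_mktuple; change (B (nat_of_ord i) (X i.+2%:Z w)).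
  have [ik|ni] := ltnP i n.
    by have := Bw (Ordinal ik); rewrite nth_W0 ?ltnS.
  by have -> : i = n :> nat by apply/eqP; rewrite eqn_leq ni -ltnS ltn_ord.
move=> Bw; split => [i|]; last by have := Bw ord_max; rewrite tnth_mktuple.
by have := Bw (widen_ord (leqnSn n) i); rewrite tnth_mktuple nth_W0 ?ltnS.
Qed.

Let W0_box C : W0 @^-1` tuple_box n.+1 C = cylinder X C n.+1 0.
Proof.
apply/seteqP; split => w Cw i; rewrite ?tnth_mktuple ?add0r.
  by move=> ik; have := Cw (Ordinal ik); rewrite tnth_mktuple.
by have := Cw i (ltn_ord i); rewrite add0r.
Qed.

Let W1_box C : W1 @^-1` tuple_box n.+1 C = cylinder X C n.+1 1.
Proof.
apply/seteqP; split => w Cw i; rewrite ?tnth_mktuple.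
  by move=> ik; have := Cw (Ordinal ik); rewrite tnth_mktuple.
exact: Cw i (ltn_ord i).
Qed.

(** The reversal of windows comes from that of [K] at a single step. For a box B, the left side
    integrates [\1_(B 0) * K x A] times the probability of the remaining sides, the right side
    integrates [\1_A] times a K-step into the whole box; [time_reversal_integral] exchanges them. *)
Let first_step_mass A B : measurable A -> measurable B ->
  \int[pi]_(x in B) K (nth point x 0) A = P (X 1 @^-1` A `&` W1 @^-1` B).
Proof.
move=> mA mB; have mid : measurable_fun setT (@id (n.+1.-tuple E)).
  exact: measurable_id.
have mKA := measurable_kernel K A mA.
have mK0 := measurableT_comp mKA (@measurable_nth _ E n.+1 0).
have diracE C : \int[pi]_(x in C) K (nth point x 0) A =
    \int[pi]_x (K (nth point x 0) A * kdirac mid x C).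
  by rewrite integral_indicl; apply: eq_integral => x _; rewrite muleC.
rewrite diracE; apply: mixture_box_unique => //; first exact: measurable_X.
move=> {mB} {}B mB; rewrite -diracE.
have mBS i : measurable ((B \o S) i) by exact: mB.
have mG := measurable_cylinder_prob K n mBS.
have G0 := cylinder_prob_ge0 K (B \o S) n.
have m1 C : measurable C -> measurable_fun setT (fun x : E => (\1_C x)%:E : \bar R).
  by move=> mC; exact/measurable_EFinP.
rewrite window_law_integral_in//; last exact: measurable_tuple_box.
rewrite W0_box W1_box (cylinderE chain)//; last exact: past_preimage.
have C0 C (x : E) : 0 <= (\1_C x)%:E :> \bar R by rewrite lee_fin.
have g0 x : 0 <= (\1_(B 0%N) x)%:E * K x A by rewrite mule_ge0.
have mg : measurable_fun setT (fun x => (\1_(B 0%N) x)%:E * K x A).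
  by apply: emeasurable_funM => //; exact: m1.
have h0 x : 0 <= (\1_(B 0%N) x)%:E * cylinder_prob K (B \o S) n x by rewrite mule_ge0.
have mh : measurable_fun setT (fun x => (\1_(B 0%N) x)%:E * cylinder_prob K (B \o S) n x).
  by apply: emeasurable_funM => //; exact: m1.
have f0 x : 0 <= (\1_A x)%:E * cylinder_prob K B n.+1 x.
  by rewrite mule_ge0// cylinder_prob_ge0.
have mf : measurable_fun setT (fun x => (\1_A x)%:E * cylinder_prob K B n.+1 x).
  by apply: emeasurable_funM; [exact: m1|exact: measurable_cylinder_prob].
transitivity (\int[nu]_x (cylinder_prob K (B \o S) n x * ((\1_(B 0%N) x)%:E * K x A))).
  rewrite -(cylinder_weight chain n 1 mBS g0 mg).
  rewrite cylinderS add0r setIC integral_mkcondr; apply: eq_integral => w _.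
  by rewrite epatch_indic/= muleC nth_W0.
transitivity (\int[nu]_x ((\1_A x)%:E * cylinder_prob K B n.+1 x)); last first.
  by rewrite [RHS]integral_indicl; apply/esym; exact: (marginal_integral chain 1 f0 mf).
rewrite [RHS](time_reversal_integral revK h0 mh (C0 A) (m1 A mA)).
apply: eq_integral => x _.
by rewrite integral_indic// setIT muleCA muleA.
Qed.

(** For a box A, all sides but the first are absorbed into B, and the first one is left to
    [first_step_mass]. *)
Let backward_mass A B : measurable A -> measurable B ->
  \int[pi]_(x in B) backward_kernel K n.+1 x A = P (W0 @^-1` A `&` W1 @^-1` B).
Proof.
move=> mA mB; rewrite setIC integral_indicl.
apply: mixture_box_unique => //; [exact/measurable_EFinP|exact: measurable_W1|].
move=> {mA} {}A mA; have mboxA : measurable (tuple_box n.+1 A).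
  exact: measurable_tuple_box.
rewrite -integral_indicl.
pose B' := B `&` [set x | forall i : 'I_n, A i.+1 (nth point x i)].
have mB' : measurable B'.
  apply: measurableI => //.
  rewrite (_ : [set _ | _] = \bigcap_(i in [set: 'I_n])
      ((fun x => nth point x i) @^-1` A i.+1)).
    apply: fin_bigcap_measurable => // i _.
    by rewrite -[X in measurable X]setTI; exact: measurable_nth.
  by apply/seteqP; split => [x Bx i _|x Bx i]; exact: Bx.
transitivity (\int[pi]_(x in B') K (nth point x 0) (A 0%N)).
  rewrite integral_mkcondr; apply: eq_integral => x _.
  rewrite patchE kmapE; last exact: measurable_tuple_box.
  case: ifPn => [|]; rewrite ?inE ?notin_setE => Bx.
    congr (K _ _); apply/seteqP; split => z /=; first by move=> /unshift_box[].
    by move=> Bz; apply/unshift_box.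
  rewrite (_ : [set _ | _] = set0) ?measure0//; apply/seteqP; split => // z /=.
  by move=> /unshift_box[].
rewrite first_step_mass//; congr (P _).
rewrite /B' preimage_setI setICA; congr (_ `&` _).
apply/seteqP; split => w.
  move=> [A0 Aw] [[|i] ik]; rewrite tnth_mktuple//.
  have := Aw (Ordinal (ik : (i < n)%N)).
  by rewrite -(tnth_nth _ _ (Ordinal (ltnW ik))) tnth_mktuple.
move=> Aw; split => [|i]; first by have := Aw ord0; rewrite tnth_mktuple.
have := Aw (lift ord0 i); rewrite tnth_mktuple.
by rewrite -(tnth_nth _ _ (widen_ord (leqnSn n) i)) tnth_mktuple.
Qed.

Lemma window_time_reversal :
  time_reversal pi (forward_kernel K n.+1) (backward_kernel K n.+1).
Proof. by move=> A B mA mB; rewrite forward_mass// backward_mass. Qed.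

End window_time_reversal.

(** * The Green-Kubo operator on combinations of coordinates *)

Section L2_lemmas.
Context d (T : measurableType d) (R : realType) (mu : probability T R).
Implicit Types f g : T -> R.

Lemma norm2_ae_eq f g : measurable_fun setT f -> measurable_fun setT g ->
  f = g %[ae mu] -> norm2 mu f = norm2 mu g.
Proof.
move=> mf mg fg; rewrite /norm2 unlock; congr (_ `^ _)%E.
have mpow (k : T -> R) : measurable_fun setT k ->
    measurable_fun setT (fun x => (`|k x| `^ 2)%:E).
  move=> mk; apply/measurable_EFinP.
  by apply: (measurableT_comp (measurable_powR _)); exact: measurableT_comp.
apply: ae_eq_integral => //; [exact: mpow..|].
by apply: filterS fg => x fg _ /=; rewrite fg.
Qed.

Lemma norm2Z c f : f \in Lfun mu 2%:E ->
  norm2 mu (fun x => c * f x) = (`|c|%:E * norm2 mu f)%E.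
Proof. by move=> f2; have := LnormZ (Lfun_Sub (lee1n 2) f2) c. Qed.

Lemma norm2_sub_le f g : measurable_fun setT f -> measurable_fun setT g ->
  (norm2 mu (fun x => f x - g x)%R <= norm2 mu f + norm2 mu g)%E.
Proof.
move=> mf mg; have mNg : measurable_fun setT (\- g) by exact: measurable_funN.
have := eminkowski mu mf mNg (lee1n 2); congr (_ <= _ + _)%E.
exact: (oppe_Lnorm mu (EFin \o g) 2%:E).
Qed.

Lemma norm2_fin_num f : f \in Lfun mu 2%:E -> norm2 mu f \is a fin_num.
Proof.
move=> f2; rewrite ge0_fin_numE ?Lnorm_ge0//.
by have := sub_Lfun_finLfun f2; rewrite inE.
Qed.

Lemma norm2_eq0 f : measurable_fun setT f -> norm2 mu f = 0%E -> f = cst 0 %[ae mu].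
Proof.
move=> mf /Lnorm_eq0_eq0 f0; have : EFin \o f = \0%E %[ae mu].
  by apply: f0 => //; exact/measurable_EFinP.
by apply: filterS => x /(_ I) [].
Qed.

Lemma norm2_cst0 : norm2 mu (cst 0) = 0%E.
Proof. by rewrite /norm2 Lnorm0. Qed.

Lemma L20_Lfun f : L20 mu f -> f \in Lfun mu 2%:E.
Proof. by case. Qed.

Lemma L20_linear c f g : L20 mu f -> L20 mu g -> L20 mu (fun x => c * f x + g x).
Proof.
move=> [f2 f0] [g2 g0]; split.
  by have [_ lin] := @Lfun_submod_closed _ _ _ mu 2%:E (lee1n 2); exact: lin.
have fi := Lfun2_integrable f2; have gi := Lfun2_integrable g2.
have cfi : mu.-integrable setT (EFin \o (fun x => c * f x)).
  by have := integrableZl measurableT c fi.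
by rewrite RintegralD// RintegralZl// f0 g0 mulr0 addr0.
Qed.

Lemma L20_cst0 : L20 mu (cst 0).
Proof.
split; first exact: Lfun_cst.
by rewrite Rintegral_cst// mul0r.
Qed.

Lemma L20_sum n (c : nat -> R) (f : nat -> T -> R) :
  (forall i, (i < n)%N -> L20 mu (f i)) ->
  L20 mu (fun x => \sum_(i < n) c i * f i x).
Proof.
elim: n => [|n IH] Lf.
  rewrite (_ : (fun _ => _) = cst 0); first exact: L20_cst0.
  by apply/funext => x; rewrite big_ord0.
rewrite (_ : (fun _ => _) =
    (fun x => c n * f n x + \sum_(i < n) c i * f i x)); last first.
  by apply/funext => x; rewrite big_ord_recr/= addrC.
by apply: L20_linear; [exact: Lf|apply: IH => i ni; apply: Lf; exact: ltnW].
Qed.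

End L2_lemmas.

Section coordinates.
Context dE (E : measurableType dE) (R : realType) (k : nat).
Context (nu : probability E R) (pi : probability (k.-tuple E) R).
Hypothesis marginal : forall i (f : E -> \bar R), (i < k)%N ->
  (forall x, 0 <= f x)%E -> measurable_fun setT f ->
  (\int[pi]_x f (nth point x i) = \int[nu]_x f x)%E.
Implicit Types (f : E -> R) (i : nat).

Lemma measurable_coordinate_fun f i : measurable_fun setT f ->
  measurable_fun setT (coordinate_fun (k := k) f i).
Proof. by move=> mf; exact: (measurableT_comp mf (measurable_nth i)). Qed.

Lemma coordinate_norm2 f i : (i < k)%N -> measurable_fun setT f ->
  norm2 pi (coordinate_fun f i) = norm2 nu f.
Proof.
move=> ik mf; rewrite /norm2 unlock; congr (_ `^ _)%E.
apply: (marginal ik) => [x|]; first by rewrite lee_fin powR_ge0.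
apply/measurable_EFinP.
by apply: (measurableT_comp (measurable_powR _)); exact: measurableT_comp.
Qed.

Lemma coordinate_Rintegral f i : (i < k)%N -> measurable_fun setT f ->
  \int[pi]_x coordinate_fun f i x = \int[nu]_x f x.
Proof.
move=> ik mf; have mef : measurable_fun setT (EFin \o f) by exact/measurable_EFinP.
congr fine; rewrite integralE [RHS]integralE; congr (_ - _)%E.
  rewrite -(marginal ik)//; last exact: measurable_funepos.
  by apply: eq_integral => x _; rewrite !funeposE.
rewrite -(marginal ik)//; last exact: measurable_funeneg.
by apply: eq_integral => x _; rewrite !funenegE.
Qed.

Lemma coordinate_L20 f i : (i < k)%N -> L20 nu f -> L20 pi (coordinate_fun f i).
Proof.
move=> ik [f2 f0]; have mf := Lfun2_mfun f2; split; last by rewrite coordinate_Rintegral.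
rewrite inE; apply/andP; split; rewrite inE/=; first exact: measurable_coordinate_fun.
rewrite /finite_norm -/(norm2 pi _) coordinate_norm2//.
by have := norm2_fin_num f2; rewrite ge0_fin_numE ?Lnorm_ge0.
Qed.

(** Each coordinate has law nu under pi, so nu-null sets pull back to pi-null sets. This carries the
    eigenvalue equation from [E] to the entries of a window. *)
Lemma coordinate_ae i (Z : set E) : (i < k)%N -> {ae nu, forall x, Z x} ->
  {ae pi, forall x : k.-tuple E, Z (nth point x i)}.
Proof.
move=> ik [N [mN N0 ZN]].
exists ((fun x : k.-tuple E => nth point x i) @^-1` N); split.
- by rewrite -[X in measurable X]setTI; exact: measurable_nth.
- have mi : measurable ((fun x : k.-tuple E => nth point x i) @^-1` N).
    by rewrite -[X in measurable X]setTI; exact: measurable_nth.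
  transitivity (\int[pi]_x (\1_N (nth point x i))%:E)%E.
    by rewrite (integral_indic pi measurableT mi) setIT.
  have N1 x : (0 <= (\1_N x)%:E :> \bar R)%E by rewrite lee_fin.
  have m1N : measurable_fun setT (fun x => (\1_N x)%:E : \bar R).
    exact/measurable_EFinP.
  by rewrite (marginal ik N1 m1N) integral_indic// setIT.
- by move=> x /= Zx; apply: ZN.
Qed.

End coordinates.

(** * Coefficient vectors and the linear system for the sums *)

Section coefficients.
Context (R : realType) (k : nat) (lambda : R).
Implicit Types a : nat -> R.

(** The matrix of P_k on e_1, ..., e_k, numbered from 0. It is cut off at k so that coefficient
    vectors can be compared as functions on [nat]. *)
Definition shift_coef a (j : nat) : R :=
  if (j < k)%N then
    (if j is j'.+1 then a j' else 0) + (if j == k.-1 then lambda * a k.-1 else 0)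
  else 0.

(** Conjugation by this reflection turns the action of P_k into that of its adjoint, so one
    computation serves both series. *)
Definition rev_coef a (j : nat) : R := a (k.-1 - j)%N.

Definition Mcoef (j : nat) : R :=
  if (j < k)%N then
    1 + ((j == 0)%N%:R + (j == k.-1)%N%:R) * (lambda / (1 - lambda))
  else 0.

(* I - shift_coef maps this vector to the image of Mcoef under shift_coef, so
   that it gives the sum of the iterates of P_k at M_{lambda,k} *)
Definition Fcoef (j : nat) : R :=
  if (j < k)%N then
    j%:R + ((0 < j)%N%:R + (j == k.-1)%N%:R * theta k lambda) * (lambda / (1 - lambda))
  else 0.

Hypothesis k2 : (2 <= k)%N.

Lemma rev_Mcoef j : (j < k)%N -> rev_coef Mcoef j = Mcoef j.
Proof.
move=> jk; rewrite /rev_coef /Mcoef jk (_ : (k.-1 - j < k)%N); last by lia.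
have -> : (k.-1 - j == 0)%N = (j == k.-1)%N by lia.
have -> : (k.-1 - j == k.-1)%N = (j == 0)%N by lia.
by rewrite (addrC (j == 0)%N%:R).
Qed.

Lemma rev_shift_coef a j : (j < k)%N -> rev_coef (shift_coef a) j =
  (if (j < k.-1)%N then rev_coef a j.+1 else 0) +
  (if (j == 0)%N then lambda * rev_coef a 0 else 0).
Proof.
move=> jk; rewrite /rev_coef /shift_coef (_ : (k.-1 - j < k)%N); last by lia.
rewrite subn0 (_ : (k.-1 - j == k.-1)%N = (j == 0)%N); last by lia.
congr (_ + _); have [jk1|kj] := ltnP j k.-1.
  by rewrite (_ : (k.-1 - j = (k.-1 - j.+1).+1)%N); last by lia.
by rewrite (_ : (k.-1 - j = 0)%N); last by lia.
Qed.

Lemma iter_shift_delta_last r :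
  iter r shift_coef (fun j => (j == k.-1)%N%:R) =
  (fun j => lambda ^+ r * (j == k.-1)%N%:R).
Proof.
elim: r => [|r /= ->]; first by apply/funext => j; rewrite mul1r.
apply/funext => j; rewrite /shift_coef eqxx mulr1 exprS.
have [->|jk1] := eqVneq j k.-1.
  rewrite (_ : (k.-1 < k)%N); last by lia.
  have -> : k.-1 = k.-2.+1 by lia.
  by rewrite (ltn_eqF (ltnSn _)) mulr0 add0r mulr1.
rewrite mulr0 addr0; case: ifP => // jk; case: j jk1 jk => // j _ jk.
by rewrite (_ : (j == k.-1)%N = false) ?mulr0//; lia.
Qed.

Lemma shift_coefB a b :
  shift_coef (fun j => a j - b j) = (fun j => shift_coef a j - shift_coef b j).
Proof.
apply/funext => j; rewrite /shift_coef; case: ifP => _; last by rewrite subr0.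
by case: j => [|j]; case: ifP => _; ring.
Qed.

Lemma iter_shift_coefB r a b : iter r shift_coef (fun j => a j - b j) =
  (fun j => iter r shift_coef a j - iter r shift_coef b j).
Proof. by elim: r => //= r ->; rewrite shift_coefB. Qed.

(** Each step moves the coefficients up one place and brings in a zero at the bottom; only the last
    position retains anything. *)
Lemma iter_shift_coef_lt r a j : (j < r)%N -> (j < k.-1)%N ->
  iter r shift_coef a j = 0.
Proof.
elim: r j => [//|r IH] j jr jk /=; rewrite /shift_coef.
rewrite (ltn_eqF jk) addr0; case: ifP => // _.
by case: j jr jk => // j jr jk; apply: IH => //; exact: ltnW.
Qed.

Lemma iter_shift_coef_last r a :
  iter (k + r) shift_coef a k.-1 = lambda ^+ r * iter k shift_coef a k.-1.
Proof.
elim: r => [|r IH]; first by rewrite addn0 mul1r.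
rewrite addnS /= {1}/shift_coef eqxx (_ : (k.-1 < k)%N); last by lia.
rewrite IH exprS -mulrA (_ : (match k.-1 with _.+1 => _ | _ => _ end) = 0) ?add0r//.
have -> : k.-1 = k.-2.+1 by lia.
by apply: iter_shift_coef_lt; lia.
Qed.

Hypothesis lambda1 : lambda != 1.

Let lambda10 : 1 - lambda != 0. Proof. by rewrite subr_eq0 eq_sym. Qed.

Lemma thetaE : theta k lambda = k%:R + 2 * (lambda / (1 - lambda)).
Proof. by rewrite /theta; field. Qed.

(** [Fcoef] at j is the total weight of M at positions below j, all of which passes through j. At
    the last position every coefficient of M, of total [theta k lambda], also adds its geometric
    tail. *)
Lemma Fcoef_resolvent j : Fcoef j - shift_coef Fcoef j = shift_coef Mcoef j.
Proof.
rewrite /shift_coef /Fcoef /Mcoef !thetaE; move: k2; case: k => [|[|m]]//= _.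
case: j => [|j] /=; first by rewrite mul0r !addr0 subr0 mul0r addr0.
have [jm|_] := ltnP j.+1 m.+2; last by rewrite subr0.
rewrite ltnSn eqxx eqSS (ltnW jm) (_ : (j == m.+1)%N = false); last by lia.
have [->|_] := eqVneq j m; first by case: m {jm} => [|m] /=; field.
by case: j {jm} => [|j] /=; field.
Qed.

(** The counts j and k - 1 - j from the two directions add up to k - 1, and M itself supplies the
    missing 1; the rest is the boundary correction. *)
Lemma theta_Mcoef j : (j < k)%N ->
  theta k lambda * Mcoef j = Mcoef j + Fcoef j + rev_coef Fcoef j.
Proof.
move=> jk; rewrite /rev_coef /Fcoef /Mcoef thetaE jk.
have -> : (k.-1 - j < k)%N by lia.
have -> : (0 < k.-1 - j)%N = (j != k.-1) by lia.
have -> : (k.-1 - j == k.-1)%N = (j == 0)%N by lia.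
rewrite natrB; last by lia.
have -> : k.-1%:R = k%:R - 1 :> R by rewrite -subn1 natrB//; lia.
rewrite lt0n.
by case: (j == 0)%N; case: (j == k.-1)%N => /=; field.
Qed.

(** By [Fcoef_resolvent] each term is a difference of consecutive iterates of [Fcoef], so the sum
    telescopes. *)
Lemma sum_iter_shift_Mcoef N j :
  \sum_(1 <= r < N.+1) iter r shift_coef Mcoef j = Fcoef j - iter N shift_coef Fcoef j.
Proof.
elim: N => [|N IH]; first by rewrite big_geq// subrr.
rewrite big_nat_recr//= IH.
have -> : shift_coef (iter N shift_coef Mcoef) j =
    iter N shift_coef Fcoef j - shift_coef (iter N shift_coef Fcoef) j.
  rewrite -!iterS !iterSr.
  rewrite (_ : shift_coef Mcoef = fun j => Fcoef j - shift_coef Fcoef j).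
    by rewrite iter_shift_coefB.
  by apply/funext => i; rewrite Fcoef_resolvent.
by ring.
Qed.

Lemma shift_MB j : shift_coef Mcoef j - Mcoef j =
  ((j == 1)%N%:R * lambda - (j == 0)%N%:R) / (1 - lambda).
Proof.
rewrite /shift_coef /Mcoef; move: k2; case: k => [|[|m]]//= _.
have eq0 i : (i.+1 == 0)%N = false by [].
case: j => [|j] /=; first by field.
rewrite !eqSS ?eq0; have [jm|mj] := ltnP j.+1 m.+2; last first.
  by rewrite (_ : (j == 0)%N = false) /=; [field|lia].
rewrite ltnSn eqxx (ltnW jm) (_ : (j == m.+1)%N = false); last by lia.
have [->|_] := eqVneq j m.
  by case: m {jm} => [|m]; rewrite ?eqxx ?eq0 /=; field.
by case: j {jm} => [|j]; rewrite ?eqxx ?eq0 /=; field.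
Qed.

End coefficients.

Section coordinate_combinations.
Context dE (E : measurableType dE) (R : realType) (k : nat) (h : E -> R).
Implicit Types a b : nat -> R.

Definition comb a (x : k.-tuple E) : R := \sum_(j < k) a j * coordinate_fun h j x.

Lemma eq_comb a b : (forall j, (j < k)%N -> a j = b j) -> comb a = comb b.
Proof.
by move=> ab; apply/funext => x; apply: eq_bigr => j _; rewrite ab.
Qed.

Lemma combD a b x : comb (fun j => a j + b j) x = comb a x + comb b x.
Proof. by rewrite -big_split; apply: eq_bigr => j _; rewrite mulrDl. Qed.

Lemma combB a b x : comb (fun j => a j - b j) x = comb a x - comb b x.
Proof. by rewrite -sumrB; apply: eq_bigr => j _; rewrite mulrBl. Qed.

Lemma combZ c a x : comb (fun j => c * a j) x = c * comb a x.
Proof. by rewrite mulr_sumr; apply: eq_bigr => j _; rewrite mulrA. Qed.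

Lemma comb_sum (r : seq nat) (a : nat -> nat -> R) x :
  comb (fun j => \sum_(i <- r) a i j) x = \sum_(i <- r) comb (a i) x.
Proof.
by rewrite exchange_big; apply: eq_bigr => j _; rewrite mulr_suml.
Qed.

Lemma comb_delta i x : (i < k)%N ->
  comb (fun j => (j == i)%:R) x = coordinate_fun h i x.
Proof.
move=> ik; rewrite /comb (bigD1 (Ordinal ik))//= eqxx mul1r big1 ?addr0// => j ji.
by rewrite -val_eqE/= in ji; rewrite (negbTE ji) mul0r.
Qed.

Hypothesis mh : measurable_fun setT h.

Lemma measurable_comb a : measurable_fun setT (comb a).
Proof.
apply: measurable_sum => j; apply: measurable_funM => //.
exact: measurable_coordinate_fun.
Qed.

End coordinate_combinations.

Lemma big_ord_pred_recr (V : zmodType) k (F : nat -> V) : (0 < k)%N ->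
  \sum_(j < k) F j = \sum_(j < k.-1) F j + F k.-1.
Proof. by case: k => // k _; rewrite big_ord_recr. Qed.

Lemma big_ord_pred_recl (V : zmodType) k (F : nat -> V) : (0 < k)%N ->
  \sum_(j < k) F j = F 0%N + \sum_(j < k.-1) F j.+1.
Proof. by case: k => // k _; rewrite big_ord_recl. Qed.

Lemma Mfun_comb dE (E : measurableType dE) (R : realType) (k : nat)
    (lambda : R) (h : E -> R) : (2 <= k)%N -> lambda != 1 ->
  Mfun (k := k) lambda h = comb (k := k) h (Mcoef k lambda).
Proof.
move=> k2 l1; apply/funext => x; rewrite /Mfun /comb.
have l10 : 1 - lambda != 0 by rewrite subr_eq0 eq_sym.
pose F j := Mcoef k lambda j * coordinate_fun h j x.
rewrite (big_ord_pred_recr F); last by lia.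
rewrite -(big_mkord xpredT F) big_ltn; last by lia.
rewrite /F {F}.
rewrite /Mcoef; congr (_ * _ + _ + _ * _).
- by rewrite eqxx (_ : (0 < k)%N) 1?(_ : (0 == k.-1)%N = false) /=; [field|lia..].
- apply: eq_big_nat => j /andP[j0 jk].
  rewrite (_ : (j < k)%N) 1?(_ : (j == 0)%N = false) 1?(_ : (j == k.-1)%N = false); try lia.
  by rewrite addr0 mul0r addr0 mul1r.
- by rewrite eqxx (_ : (k.-1 < k)%N) 1?(_ : (k.-1 == 0)%N = false) /=; [field|lia..].
Qed.

(** * The window operators on combinations of coordinates *)

Section window_operators.
Context dE (E : measurableType dE) (R : realType) (k : nat) (h : E -> R).
Context (nu : probability E R) (pi : probability (k.-tuple E) R).
Context (K : R.-pker E ~> E) (lambda : R).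
Hypothesis k2 : (2 <= k)%N.
Hypothesis marginal : forall i (f : E -> \bar R), (i < k)%N ->
  (forall x, 0 <= f x)%E -> measurable_fun setT f ->
  (\int[pi]_x f (nth point x i) = \int[nu]_x f x)%E.
Hypothesis revK : reversible nu K.
Hypothesis rev : time_reversal pi (forward_kernel K k) (backward_kernel K k).
Hypothesis Lh : L20 nu h.
Hypothesis Kh : Kop K h = (fun x => lambda * h x) %[ae nu].
Implicit Types a b : nat -> R.
Local Notation comb := (comb (k := k) h).

Let mh : measurable_fun setT h := Lfun2_mfun (L20_Lfun Lh).

Lemma comb_L20 a : L20 pi (comb a).
Proof.
by apply: L20_sum => i ik; exact: (coordinate_L20 marginal).
Qed.

Let h_ae i : (i < k)%N -> {ae pi, forall x : k.-tuple E,
  (K (nth point x i)).-integrable setT (EFin \o h) /\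
  Kop K h (nth point x i) = lambda * h (nth point x i)}.
Proof.
move=> ik; apply: (coordinate_ae marginal (Z := fun y =>
  (K y).-integrable setT (EFin \o h) /\ Kop K h y = lambda * h y) ik).
have hi := integrable_kernel_ae (time_reversal_invariant revK)
  (Lfun2_integrable (L20_Lfun Lh)).
by apply: filterS2 hi Kh => y hy Khy; split => //; exact: Khy.
Qed.

Let Rintegral_affine y c e : (K y).-integrable setT (EFin \o h) ->
  \int[K y]_z (c + e * h z) = c + e * Kop K h y.
Proof.
move=> hi.
have ci : (K y).-integrable setT (EFin \o (fun=> c)).
  apply/integrableP; split; first exact/measurable_EFinP/measurable_cst.
  by rewrite (eq_integral (cst `|c%:E|%E))// integral_cst// prob_kernel mule1 ltry.
have ehi : (K y).-integrable setT (EFin \o (fun z => e * h z)).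
  by have := integrableZl measurableT e hi.
by rewrite RintegralD// RintegralZl// Rintegral_cst// prob_kernel mulr1.
Qed.

(** Only the last entry of the shifted window is random, so the integrand is affine in [h z], and
    the eigenvalue equation at x_k gives its integral. *)
Lemma Pk_comb a : Pk K (comb a) = comb (shift_coef k lambda a) %[ae pi].
Proof.
have k1 : (k.-1 < k)%N by lia.
have k0 : (0 < k)%N by lia.
apply: filterS (h_ae k1) => x [hi Khx] _.
have lastE z : nth point (shift_window x z) k.-1 = z.
  rewrite -(tnth_nth _ _ (Ordinal k1)) tnth_mktuple/= prednK//.
  by rewrite nth_default// size_tuple.
have nthE z j : (j < k.-1)%N -> nth point (shift_window x z) j = nth point x j.+1.
  move=> jk; have jk' : (j < k)%N by lia.
  rewrite -(tnth_nth _ _ (Ordinal jk')) tnth_mktuple/=.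
  by apply: set_nth_default; rewrite size_tuple; lia.
pose c := \sum_(j < k.-1) a j * h (nth point x j.+1).
transitivity (\int[K (nth point x k.-1)]_z (c + a k.-1 * h z)).
  apply: eq_Rintegral => z _; rewrite /comb /coordinate_fun.
  rewrite (big_ord_pred_recr (fun j => a j * h (nth point (shift_window x z) j)))//.
  by rewrite lastE; congr (_ + _); apply: eq_bigr => j _; rewrite nthE.
rewrite Rintegral_affine// Khx /comb /coordinate_fun.
rewrite (big_ord_pred_recl (fun j => shift_coef k lambda a j * h (nth point x j)))//.
rewrite {1}/shift_coef k0 (_ : (0 == k.-1)%N = false); last by lia.
rewrite addr0 mul0r add0r /c; have k10 : (0 < k.-1)%N by lia.
rewrite (big_ord_pred_recr (fun j => a j * h (nth point x j.+1)) k10).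
rewrite (big_ord_pred_recr
  (fun j => shift_coef k lambda a j.+1 * h (nth point x j.+1)) k10).
rewrite -addrA; congr (_ + _).
  apply: eq_bigr => -[j jk] _ /=; rewrite /shift_coef (_ : (j.+1 < k)%N); last by lia.
  by rewrite (_ : (j.+1 == k.-1)%N = false) ?addr0//; lia.
rewrite /shift_coef /=; have -> : k.-2.+1 = k.-1 by lia.
by rewrite k1 eqxx mulrDl mulrCA mulrA.
Qed.

Lemma backward_comb a : Kop (backward_kernel K k) (comb (rev_coef k a)) =
  comb (rev_coef k (shift_coef k lambda a)) %[ae pi].
Proof.
have k0 : (0 < k)%N by lia.
apply: filterS (h_ae k0) => x [hi Khx] _.
rewrite Kop_backward; last exact: measurable_comb.
have headE z : nth point (unshift_window x z) 0 = z.
  by rewrite -(tnth_nth _ _ (Ordinal k0)) tnth_mktuple.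
have nthE z j : (j.+1 < k)%N -> nth point (unshift_window x z) j.+1 = nth point x j.
  by move=> jk; rewrite -(tnth_nth _ _ (Ordinal jk)) tnth_mktuple.
pose b := rev_coef k a; pose c := \sum_(j < k.-1) b j.+1 * h (nth point x j).
transitivity (\int[K (nth point x 0)]_z (c + b 0%N * h z)).
  apply: eq_Rintegral => z _; rewrite /comb /coordinate_fun.
  rewrite (big_ord_pred_recl (fun j => b j * h (nth point (unshift_window x z) j)))//.
  rewrite headE addrC; congr (_ + _); apply: eq_bigr => -[j jk] _ /=.
  by rewrite nthE//; lia.
rewrite Rintegral_affine// Khx /comb /coordinate_fun.
rewrite (eq_bigr (fun j : 'I_k => (if (j < k.-1)%N then b j.+1 else 0) * h (nth point x j)
    + (if (j == 0 :> nat)%N then lambda * b 0%N else 0) * h (nth point x j))); last first.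
  by move=> j _; rewrite -mulrDl rev_shift_coef.
rewrite big_split; congr (_ + _).
  rewrite (big_ord_pred_recr (fun j =>
    (if (j < k.-1)%N then b j.+1 else 0) * h (nth point x j)) k0).
  rewrite ltnn mul0r addr0; apply: eq_bigr => j _.
  by rewrite ltn_ord.
rewrite (big_ord_pred_recl (fun j =>
  (if (j == 0)%N then lambda * b 0%N else 0) * h (nth point x j)) k0).
rewrite big1 => [|j _]; last by rewrite mul0r.
by rewrite eqxx addr0 mulrCA mulrA.
Qed.

(** The backward kernel yields this combination only almost everywhere, but [Pk_adjoint] tests inner
    products, so the combination may serve as representative. *)
Lemma Pk_adjoint_comb a : Pk_adjoint K pi (comb (rev_coef k a))
  (comb (rev_coef k (shift_coef k lambda a))).
Proof.
split=> [|u Lu]; first exact: comb_L20.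
have mu_ := Lfun2_mfun (L20_Lfun Lu).
rewrite PkE// (time_reversal_dot rev (L20_Lfun Lu) (L20_Lfun (comb_L20 _))).
rewrite dotC [RHS]dotC; apply: ae_eq_dot => //; last exact: backward_comb.
- by apply: measurable_Kop; exact: measurable_comb.
- exact: measurable_comb.
Qed.

Lemma measurable_iter_Pk r f : measurable_fun setT f ->
  measurable_fun setT (iter r (Pk (k := k) K) f).
Proof.
by move=> mf; elim: r => //= r IH; rewrite PkE//; exact: measurable_Kop.
Qed.

Lemma Pk_ae_eq f g : measurable_fun setT f -> measurable_fun setT g ->
  f = g %[ae pi] -> Pk (k := k) K f = Pk K g %[ae pi].
Proof.
move=> mf mg fg; rewrite !PkE//.
by apply: Kop_ae_eq => //; exact: (time_reversal_invariant rev).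
Qed.

(** An iterate may be replaced by an almost everywhere equal combination before the next step
    because pi is invariant under the forward kernel. *)
Lemma iter_Pk_comb r a :
  iter r (Pk (k := k) K) (comb a) = comb (iter r (shift_coef k lambda) a) %[ae pi].
Proof.
elim: r => [|r IH]; first exact: aeW.
have := Pk_ae_eq (measurable_iter_Pk r (measurable_comb mh a)) (measurable_comb mh _) IH.
by move=> E1; have := Pk_comb (iter r (shift_coef k lambda) a);
  apply: filterS2 E1 => x /= -> // ->.
Qed.

Lemma sum_iter_Pk_comb N a :
  (fun x => \sum_(1 <= r < N.+1) iter r (Pk (k := k) K) (comb a) x) =
  comb (fun j => \sum_(1 <= r < N.+1) iter r (shift_coef k lambda) a j) %[ae pi].
Proof.
elim: N => [|N IH].
  by apply: aeW => x _; rewrite comb_sum !big_geq.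
apply: filterS2 IH (iter_Pk_comb N.+1 a) => x IHx /(_ I) ix _.
rewrite comb_sum big_nat_recr// [RHS]big_nat_recr//= -comb_sum.
by rewrite -ix -IHx.
Qed.

Lemma comb_last a : (forall j, (j < k.-1)%N -> a j = 0) ->
  comb a = (fun x => a k.-1 * coordinate_fun h k.-1 x).
Proof.
move=> a0; apply/funext => x; rewrite /comb.
rewrite (big_ord_pred_recr (fun j => a j * coordinate_fun h j x)); last by lia.
by rewrite big1 ?add0r// => j _; rewrite a0// mul0r.
Qed.

Lemma comb_rev_last a : (forall j, (j < k.-1)%N -> a j = 0) ->
  comb (rev_coef k a) = (fun x => a k.-1 * coordinate_fun h 0 x).
Proof.
move=> a0; apply/funext => x; rewrite /comb.
rewrite (big_ord_pred_recl (fun j => rev_coef k a j * coordinate_fun h j x)); last by lia.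
rewrite /rev_coef subn0 big1 ?addr0// => j _.
by rewrite a0 ?mul0r//; have := ltn_ord j; lia.
Qed.

Let coord_norm2 j c : (j < k)%N ->
  norm2 pi (fun x => c * coordinate_fun h j x) = (`|c|%:E * norm2 nu h)%E.
Proof.
move=> jk; rewrite norm2Z ?(coordinate_norm2 marginal)//.
exact: (L20_Lfun (coordinate_L20 marginal jk Lh)).
Qed.

Let hfin : norm2 nu h \is a fin_num := norm2_fin_num (L20_Lfun Lh).

Let cvg_tail (C : R) : `|lambda| < 1 ->
  (`|lambda ^+ n * C|%:E * norm2 nu h)%E @[n --> \oo] --> 0%E.
Proof.
move=> l1; rewrite -(mul0e (norm2 nu h)); apply: cvgeZr => //.
apply: cvg_EFin; first by apply: nearW.
rewrite -(normr0 R^o); apply: cvg_norm; rewrite -(mul0r C).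
by apply: cvgM; [exact: cvg_expr|exact: cvg_cst].
Qed.

(** After k steps at most the last coefficient survives, and each further step multiplies it by
    lambda. [e] and [i] are parameters because the remainder of P_k ends at e_k and that of the
    adjoint at e_1. *)
Let cvg_remainder (e : (nat -> R) -> k.-tuple E -> R) i a : (i < k)%N ->
  (forall b, (forall j, (j < k.-1)%N -> b j = 0) ->
    e b = (fun x => b k.-1 * coordinate_fun h i x)) ->
  `|lambda| < 1 ->
  norm2 pi (e (iter n (shift_coef k lambda) a)) @[n --> \oo] --> 0%E.
Proof.
move=> ik eE l1; rewrite -(cvg_shiftn k) /=.
rewrite (_ : (fun _ => _) = (fun n =>
    (`|lambda ^+ n * iter k (shift_coef k lambda) a k.-1|%:E * norm2 nu h)%E)).
  exact: cvg_tail.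
apply/funext => n; rewrite addnC eE => [|j jk].
  by rewrite coord_norm2// iter_shift_coef_last.
by apply: iter_shift_coef_lt => //; lia.
Qed.

Lemma comb_marginal a : marginal_subspace nu pi (comb a).
Proof.
split; first exact: comb_L20.
move=> eps eps0; exists (fun i y => a i * h y).
  move=> i; have := L20_linear (a i) Lh (L20_cst0 nu).
  by congr L20; apply/funext => y; rewrite addr0.
rewrite (_ : (fun _ => _) = cst 0) ?norm2_cst0 ?lte_fin//.
by apply/funext => x; rewrite subrr.
Qed.

Section green_kubo.
Hypothesis lambda1 : lambda != 1.
Let W := Mcoef k lambda.
Let F := Fcoef k lambda.


(** The series for P_k sums to [Fcoef] and, the coefficients of M being symmetric, the one for the
    adjoint sums to its reflection; [theta_Mcoef] is then the eigenvalue equation. *)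
Lemma green_kubo_M : `|lambda| < 1 ->
  green_kubo K pi (comb W) (fun x => theta k lambda * comb W x).
Proof.
move=> l1; split; first exact: comb_L20.
  rewrite (_ : (fun _ => _) = comb (fun j => theta k lambda * W j)).
    exact: comb_L20.
  by apply/funext => x; rewrite combZ.
exists (comb F), (comb (rev_coef k F)).
exists (fun r => comb (rev_coef k (iter r (shift_coef k lambda) W))).
split.
- by split; exact: comb_L20.
- split; last by move=> r; exact: Pk_adjoint_comb.
  by apply: eq_comb => j jk; rewrite rev_Mcoef.
- rewrite /cvg_L2; rewrite (_ : (fun _ => _) = (fun n =>
      norm2 pi (comb (iter n (shift_coef k lambda) F)))).
    by apply: (@cvg_remainder comb k.-1) => //; [lia|exact: comb_last].
  apply/funext => n.
  (* The error of the partial sum is, almost everywhere, minus the telescoped remainder. *)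
  transitivity (norm2 pi (fun x => -1 * comb (iter n (shift_coef k lambda) F) x)).
    apply: norm2_ae_eq.
    + apply: measurable_funB; last exact: measurable_comb.
      by apply: measurable_sum => r; apply: measurable_iter_Pk; exact: measurable_comb.
    + by apply: measurable_funM => //; exact: measurable_comb.
    + apply: filterS (sum_iter_Pk_comb n W) => x /(_ I) -> _.
      rewrite (eq_comb h (b := fun j => F j - iter n (shift_coef k lambda) F j)).
        by rewrite combB mulN1r addrAC subrr add0r.
      by move=> j _; rewrite sum_iter_shift_Mcoef.
  rewrite norm2Z ?normrN1 ?mul1e//; exact: (L20_Lfun (comb_L20 _)).
- rewrite /cvg_L2; rewrite (_ : (fun _ => _) = (fun n =>
      norm2 pi (comb (rev_coef k (iter n (shift_coef k lambda) F))))).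
    by apply: (@cvg_remainder (fun b => comb (rev_coef k b)) 0%N) => //;
      [lia|exact: comb_rev_last].
  apply/funext => n.
  transitivity (norm2 pi (fun x => -1 *
      comb (rev_coef k (iter n (shift_coef k lambda) F)) x)).
    (* Equality is pointwise here: the adjoint powers were chosen to be combinations of
       coordinates. *)
    congr (norm2 pi _); apply/funext => x; rewrite -comb_sum.
    rewrite (eq_comb h (b := fun j => rev_coef k F j -
        rev_coef k (iter n (shift_coef k lambda) F) j)).
      by rewrite combB mulN1r addrAC subrr add0r.
    by move=> j _; rewrite /rev_coef sum_iter_shift_Mcoef.
  rewrite norm2Z ?normrN1 ?mul1e//; exact: (L20_Lfun (comb_L20 _)).
- apply: aeW => x _; rewrite -combZ -!combD.
  by congr (_ x); apply: eq_comb => j jk; exact: theta_Mcoef.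
Qed.

End green_kubo.

Section nonzero_eigenfunction.
Hypothesis h0 : ~ (h = cst 0 %[ae nu]).

Let h_gt0 : (0 < norm2 nu h)%E.
Proof.
rewrite lt0e Lnorm_ge0 andbT; apply/eqP => /(norm2_eq0 mh).
exact: h0.
Qed.

(* The general term lambda^n e_k of a convergent series tends to 0. *)
Lemma eigenvalue_lt1 :
  green_kubo_dom K pi (coordinate_fun h k.-1) -> `|lambda| < 1.
Proof.
move=> [g [_ _ [s [s' [b [[Ls _] _ cs _ _]]]]]].
have k1 : (k.-1 < k)%N by lia.
pose e := coordinate_fun (k := k) h k.-1.
have eE : e = comb (fun j => (j == k.-1)%N%:R).
  by apply/funext => x; rewrite comb_delta.
have me : measurable_fun setT e by exact: measurable_coordinate_fun.
have ms : measurable_fun setT s := Lfun2_mfun (L20_Lfun Ls).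
pose u n x := \sum_(1 <= r < n.+1) iter r (Pk (k := k) K) e x - s x.
have mu_ n : measurable_fun setT (u n).
  apply: measurable_funB => //; apply: measurable_sum => r.
  exact: measurable_iter_Pk.
rewrite ltNge; apply/negP => l1.
(* Consecutive errors differ by the general term, whose norm is at least that of h when |lambda| >=
   1. *)
have le_u n : (norm2 nu h <= norm2 pi (u n.+1) + norm2 pi (u n))%E.
  apply: le_trans (norm2_sub_le pi (mu_ n.+1) (mu_ n)).
  rewrite (_ : norm2 pi _ =
      norm2 pi (fun x => lambda ^+ n.+1 * coordinate_fun h k.-1 x)).
    by rewrite coord_norm2// lee_pemull// ?Lnorm_ge0// lee_fin normrX exprn_ege1.
  apply: norm2_ae_eq.
  - exact: measurable_funB.
  - exact: measurable_funM.
  - apply: filterS (iter_Pk_comb n.+1 (fun j => (j == k.-1)%N%:R)) => x /(_ I) + _.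
    rewrite -eE iter_shift_delta_last//.
    rewrite (combZ h _ (fun j => (j == k.-1)%N%:R)) comb_delta// => <-.
    by rewrite /u big_nat_recr//=; ring.
have : (norm2 nu h <= 0)%E.
  have c0 : (fun n => norm2 pi (u n)) @ \oo --> 0%E := cs.
  have c1 : (fun n => norm2 pi (u n.+1)) @ \oo --> 0%E.
    by rewrite (cvg_shiftS (fun n => norm2 pi (u n))).
  have c2 : (norm2 pi (u n.+1) + norm2 pi (u n))%E @[n --> \oo] --> 0%E.
    by rewrite -[X in _ --> X](adde0 0%E); apply: cvgeD.
  by apply: (cvge_to_ge c2); exact: nearW.
by rewrite leNgt h_gt0.
Qed.

(* P_k M - M = (lambda e_2 - e_1) / (1 - lambda), where e_1 and e_2 have the
   same norm as h. *)
Lemma comb_M_neq0 : lambda != 1 -> `|lambda| < 1 ->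
  ~ (comb (Mcoef k lambda) = cst 0 %[ae pi]).
Proof.
set W := Mcoef k lambda; move=> lambda1 l1 W0.
have l10 : 1 - lambda != 0 by rewrite subr_eq0 eq_sym.
(* M = 0 forces P_k M = 0, so the difference P_k M - M vanishes as well. *)
have SW0 : comb (shift_coef k lambda W) = cst 0 %[ae pi].
  have m0 : measurable_fun setT (cst 0 : k.-tuple E -> R) by exact: measurable_cst.
  have := Pk_ae_eq (measurable_comb mh W) m0 W0.
  apply: filterS2 (Pk_comb W) => x /(_ I) <- /(_ I) -> _.
  by rewrite /Pk Rintegral_cst// mul0r.
have e01 : coordinate_fun h 0 = (fun x => lambda * coordinate_fun h 1 x) %[ae pi].
  apply: filterS2 W0 SW0 => x /(_ I) Wx /(_ I) SWx _.
  have : comb (fun j => shift_coef k lambda W j - W j) x = 0.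
    by rewrite combB Wx SWx subrr.
  rewrite (eq_comb h (b := fun j => (1 - lambda)^-1 *
      (lambda * (j == 1)%N%:R - (j == 0)%N%:R))); last first.
    by move=> j _; rewrite shift_MB// mulrC (mulrC lambda).
  rewrite (combZ h _ (fun j => lambda * (j == 1)%N%:R - (j == 0)%N%:R)).
  rewrite (combB h (fun j => lambda * (j == 1)%N%:R) (fun j => (j == 0)%N%:R)).
  rewrite (combZ h _ (fun j => (j == 1)%N%:R)) !comb_delta//; last by lia.
  move=> /eqP; rewrite mulf_eq0 invr_eq0 (negbTE l10)/= subr_eq0 => /eqP ->//.
have : norm2 nu h = (`|lambda|%:E * norm2 nu h)%E.
  have k0 : (0 < k)%N by lia.
  rewrite -(@coord_norm2 1%N)// -(coordinate_norm2 marginal k0 mh).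
  apply: norm2_ae_eq => //; first exact: measurable_coordinate_fun.
  by apply: measurable_funM => //; exact: measurable_coordinate_fun.
move: h_gt0; rewrite -(fineK hfin) lte_fin => N0.
rewrite -EFinM => -[] NE.
by have := ltr_pM2r N0 `|lambda| 1; rewrite l1 mul1r -NE ltxx.
Qed.

End nonzero_eigenfunction.

End window_operators.

Theorem theorem3p7 (R : realType)
    (dE : measure_display) (E : measurableType dE)
    (dO : measure_display) (Omega : measurableType dO)
    (P : probability Omega R) (X : int -> {RV P >-> E})
    (nu : probability E R) (K : R.-pker E ~> E) (k : nat) :
  (2 <= k)%N ->
  stationary_markov_chain nu K X ->
  reversible nu K ->
  let pi := window_law X k in
  forall lambda : R, Spec nu K lambda -> lambda != 1 ->
  forall h : E -> R, L20 nu h -> ~ (h = cst 0 %[ae nu]) ->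
    Kop K h = (fun x => lambda * h x) %[ae nu] ->
    (forall i, (i < k)%N -> green_kubo_dom K pi (coordinate_fun h i)) ->
    [/\ marginal_subspace nu pi (Mfun lambda h),
        green_kubo_eigenfunction K pi (theta k lambda) (Mfun lambda h)
      & exists2 f, marginal_subspace nu pi f &
          green_kubo_eigenfunction K pi (theta k lambda) f].
Proof.
move=> k2 chain revK pi lambda _ lambda1 h Lh h0 Kh dom.
have k0 : (0 < k)%N by lia.
have marginal i (f : E -> \bar R) : (i < k)%N -> (forall x, 0 <= f x)%E ->
    measurable_fun setT f -> (\int[pi]_x f (nth point x i) = \int[nu]_x f x)%E.
  (* The results on the window law are stated for length [n.+1], which guarantees a first and a last
     coordinate. *)
  rewrite /pi; move: (k) k0 => [//|n] _; exact: (window_marginal chain).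
have rev : time_reversal pi (forward_kernel K k) (backward_kernel K k).
  rewrite /pi; move: (k) k0 => [//|n] _; exact: (window_time_reversal chain revK).
have k1 : (k.-1 < k)%N by lia.
have l1 : `|lambda| < 1 := eigenvalue_lt1 k2 marginal revK rev Lh Kh h0 (dom _ k1).
rewrite (Mfun_comb _ k2 lambda1).
have MS := comb_marginal marginal Lh (Mcoef k lambda).
have ME : green_kubo_eigenfunction K pi (theta k lambda) (comb h (Mcoef k lambda)).
  split; first exact: (comb_L20 marginal Lh).
    exact: (comb_M_neq0 k2 marginal revK rev Lh Kh h0 lambda1 l1).
  exact: (green_kubo_M k2 marginal revK rev Lh Kh lambda1 l1).
by split => //; exists (comb h (Mcoef k lambda)).
Qed.
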